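(* Let $(E,\phi)$ be an Anderson $A$-module over $L$ and let $\mathfrak p\neq 0$ be a prime ideal of $A$ with uniformizer $\pi\in A$. Let $B(A)$ be an $\mathbb F_q$-basis of $A$ obtained by choosing lifts of an $\mathbb F_q$-basis of $A/\mathfrak p$ and successively of $\mathbb F_q$-bases of $\mathfrak p/\mathfrak p^2,\ \mathfrak p^2/\mathfrak p^3,\dots$; then every element of $E((A\otimes\mathbb C_\infty)_\mathfrak p)$ is uniquely a formal sum $\sum_{a\in B(A)}a\otimes e_a$ with $e_a\in E(\mathbb C_\infty)$. \begin{enumerate} \item There are isomorphisms of $A_\mathfrak p\otimes A$-modules \[\hat\Omega_{A_\mathfrak p/\mathbb F_\mathfrak p}\otimes_{A_\mathfrak p}E((A\otimes\mathbb C_\infty)_\mathfrak p)\longrightarrow \mathrm{Hom}_{\mathbb F_\mathfrak p}\big(K_\mathfrak p/A_\mathfrak p,\ \mathbb F_\mathfrak p\otimes E(\mathbb C_\infty)\big)\longrightarrow \mathrm{Hom}_{\mathbb F_q}\big(K_\mathfrak p/A_\mathfrak p,\ E(\mathbb C_\infty)\big),\] where the first map sends $\omega\otimes\sum_{a\in B(A)}a\otimes e_a$ to the map $x\mapsto\sum_{a\in B(A)}\mathrm{res}_\mathfrak p(xa\omega)\otimes e_a$, and the second map sends $f$ to $(\mathrm{tr}\otimes\mathrm{id})\circ f$, with $\mathrm{tr}:\mathbb F_\mathfrak p\to\mathbb F_q$ the trace. \item These restrict to isomorphisms \[\tilde\jmath_\mathfrak p:\ \hat\Omega_{A_\mathfrak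 p/\mathbb F_\mathfrak p}\otimes_{A_\mathfrak p}\hat H_\mathfrak p\to \mathrm{Hom}_{\mathbb F_\mathfrak p\otimes A}\big(K_\mathfrak p/A_\mathfrak p,\mathbb F_\mathfrak p\otimes E(\mathbb C_\infty)\big)\to \mathrm{Hom}_A\big(K_\mathfrak p/A_\mathfrak p,E(\mathbb C_\infty)\big)=T_\mathfrak p(E).\] \item The map $\jmath_\mathfrak p:\hat H_\mathfrak p\to T_\mathfrak p(E)$, $h\mapsto\tilde\jmath_\mathfrak p(d\pi\otimes h)$, is an isomorphism of $A_\mathfrak p$-modules. \end{enumerate}
   Context: $\mathbb F_q$ is a finite field, $C$ a smooth projective geometrically irreducible curve over $\mathbb F_q$, $\infty$ a closed point of $C$, $A=H^0(C\setminus\{\infty\},\mathcal O_C)$, $K=\mathrm{Frac}(A)$, and $\mathbb C_\infty$ the completion at a place above $\infty$ of an algebraic closure of $K$. Unlabeled tensor products are over $\mathbb F_q$. $L$ is a field with $K\subseteq L\subseteq\mathbb C_\infty$, $\ell:K\to L$ the inclusion. An Anderson $A$-module $(E,\phi)$ over $L$ of dimension $d$ is an $\mathbb F_q$-vector space scheme $E\cong\mathbb G_{a,L}^d$ with a ring homomorphism $\phi:A\to\mathrm{End}_{\mathbb F_q\text{-v.s.}}(E)$, $a\mapsto\phi_a$, such that $d\phi_a-\ell(a)$ is nilpotent on $\mathrm{Lie}\,E$ for all $a\in A$. For a nonzero prime $\mathfrak p$: $A_\mathfrak p$ is the $\mathfrak p$-adic completion, $K_\mathfrak p$ its fraction field,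 $\mathbb F_\mathfrak p=A/\mathfrak p$; via the unique section $\mathbb F_\mathfrak p\hookrightarrow A_\mathfrak p$ and a uniformizer $\pi\in A$ one identifies $A_\mathfrak p\cong\mathbb F_\mathfrak p[[\pi]]$, $K_\mathfrak p\cong\mathbb F_\mathfrak p((\pi))$; $\hat\Omega_{A_\mathfrak p/\mathbb F_\mathfrak p}=A_\mathfrak p\,d\pi$ is the module of continuous differentials and $\mathrm{res}_\mathfrak p:K_\mathfrak p\,d\pi\to\mathbb F_\mathfrak p$ the residue. $E[\mathfrak a]=\bigcap_{a\in\mathfrak a}\ker(\phi_a|_{E(\mathbb C_\infty)})$, and the Tate module is $T_\mathfrak p(E)=\mathrm{Hom}_A(K_\mathfrak p/A_\mathfrak p,E(\mathbb C_\infty))$. Set $E((A\otimes\mathbb C_\infty)_\mathfrak p)=\varprojlim_n (A/\mathfrak p^{n+1})\otimes E(\mathbb C_\infty)$; it carries two commuting actions: $\phi_a$ acting on the second tensor factor, and multiplication on the first tensor factor (which extends to an $A_\mathfrak p$-action), denoted $a\cdot h$. Define $\hat H_\mathfrak p=\{h\in E((A\otimes\mathbb C_\infty)_\mathfrak p):\phi_a(h)=a\cdot h\ \forall a\in A\}$. *)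

(* Defs.v *)
From HB Require Import structures.
From mathcomp Require Import all_boot all_order all_algebra all_field.
From mathcomp Require Import boolp.
Set Implicit Arguments.
Unset Strict Implicit.
Unset Printing Implicit Defensive.
Import GRing.Theory.
Local Open Scope ring_scope.
Local Open Scope quotient_scope.
#[local] Obligation Tactic := idtac.

(* Curves through their function fields.  A smooth projective geometrically *)
(* irreducible curve over the (perfect) field Fq is given by its function   *)
(* field K, whose exact constant field is Fq; its closed points are the     *)
(* valuation rings Fq <= O < K, and a function is regular at the point O    *)
(* exactly when it belongs to O.                                            *)

Definition valuation_ring (F : fieldType) (O : F -> Prop) : Prop :=
  [/\ O 1, forall x y, O x -> O y -> O (x - y),
      forall x y, O x -> O y -> O (x * y),
      forall x, O x \/ O x^-1 & exists x, ~ O x].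

Section Curve.
Variables (Fq K : fieldType) (iota : {rmorphism Fq -> K}).

Definition closed_point (O : K -> Prop) : Prop :=
  valuation_ring O /\ forall c, O (iota c).

Definition function_field : Prop :=
  exists2 x : K, ~ algebraicOver iota x &
    exists s : seq K, forall y : K,
      exists (Q : {poly Fq}) (P : 'I_(size s) -> {poly Fq}),
        Q != 0 /\ y * (map_poly iota Q).[x]
                  = \sum_i (map_poly iota (P i)).[x] * s`_i.

Definition curve : Prop :=
  function_field /\ forall y, algebraicOver iota y -> exists c, y = iota c.

Definition regular_outside (Oinf : K -> Prop) (y : K) : Prop :=
  forall O, closed_point O -> O <> Oinf -> O y.

(* A is H^0(C \ {oo}, O_C), as a subring of K through j. *)
Definition coordinate_ring (Oinf : K -> Prop) (A : comAlgType Fq)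
    (j : {rmorphism A -> K}) : Prop :=
  [/\ injective j, forall c : Fq, j c%:A = iota c
    & forall y, (exists a, j a = y) <-> regular_outside Oinf y].

End Curve.

(* Places of an algebraic closure are again valuation rings; O_oo extends   *)
(* the discrete valuation ring Oinf, so the topology it defines is metrisable *)
(* and completeness can be tested on sequences.                             *)
Section Completion.
Variables (K Kbar Cinf : fieldType) (Oinf : K -> Prop).

Definition place_above (k : {rmorphism K -> Kbar}) (Obar : Kbar -> Prop) :=
  valuation_ring Obar /\ forall x, Obar (k x) <-> Oinf x.

Definition close_to (O : Cinf -> Prop) (r x y : Cinf) : Prop := O ((x - y) / r).

Definition completion_of (c : {rmorphism Kbar -> Cinf})
    (Obar : Kbar -> Prop) (O : Cinf -> Prop) : Prop :=
  [/\ valuation_ring O, forall y, O (c y) <-> Obar y,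
      forall x r, r != 0 -> exists y, close_to O r x (c y)
    & forall u : nat -> Cinf,
        (forall r, r != 0 -> exists N, forall m n,
           (N <= m)%N -> (N <= n)%N -> close_to O r (u m) (u n)) ->
        exists l, forall r, r != 0 -> exists N, forall n,
           (N <= n)%N -> close_to O r (u n) l].

End Completion.


(* R as an algebra over L through e. *)
Definition algvia (L : comNzRingType) (R : comNzRingType)
  (e : {rmorphism L -> R}) : Type := R.

Section AlgVia.
Variables (L R : comNzRingType) (e : {rmorphism L -> R}).
Local Notation T := (algvia e).
HB.instance Definition _ := GRing.ComNzRing.copy T R.
Let scale (a : L) (x : T) : T := (e a : T) * x.
Fact algvia_scaleA a b x : scale a (scale b x) = scale (a * b) x.
Proof. by rewrite /scale rmorphM mulrA. Qed.
Fact algvia_scale1 : left_id 1 scale.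
Proof. by move=> x; rewrite /scale rmorph1 mul1r. Qed.
Fact algvia_scaleDr : right_distributive scale +%R.
Proof. by move=> a x y; rewrite /scale mulrDr. Qed.
Fact algvia_scaleDl v : {morph scale^~ v : a b / a + b}.
Proof. by move=> a b; rewrite /scale rmorphD mulrDl. Qed.
HB.instance Definition _ := GRing.Zmodule_isLmodule.Build L T
  algvia_scaleA algvia_scale1 algvia_scaleDr algvia_scaleDl.
Fact algvia_scaleAl (a : L) (x y : T) : a *: (x * y) = a *: x * y.
Proof. exact: mulrA. Qed.
HB.instance Definition _ := GRing.Lmodule_isLalgebra.Build L T algvia_scaleAl.
Fact algvia_scaleAr (a : L) (x y : T) : a *: (x * y) = x * (a *: y).
Proof. exact: mulrCA. Qed.
HB.instance Definition _ := GRing.Lalgebra_isAlgebra.Build L T algvia_scaleAr.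
End AlgVia.

(* The dual numbers L[eps]; (x, y) stands for x + y eps. *)
Definition dual (L : fieldType) : Type := (L * L)%type.

Section Dual.
Variable L : fieldType.
Local Notation D := (dual L).
HB.instance Definition _ := GRing.Lmodule.copy D (L^o * L^o)%type.
Let mul (x y : D) : D := (x.1 * y.1, x.1 * y.2 + x.2 * y.1).
Let one : D := (1, 0).
Fact dual_mulA : associative mul.
Proof.
case=> [a b] [c d] [f g]; congr pair => /=; first by rewrite mulrA.
by rewrite !mulrDr !mulrDl !mulrA addrA.
Qed.
Fact dual_mulC : commutative mul.
Proof.
case=> [a b] [c d]; congr pair => /=; first by rewrite mulrC.
by rewrite addrC (mulrC b) (mulrC a).
Qed.
Fact dual_mul1 : left_id one mul.
Proof. by case=> a b; congr pair => /=; rewrite ?mul1r // mul0r addr0. Qed.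
Fact dual_mulDl : left_distributive mul +%R.
Proof.
case=> [a b] [c d] [f g]; congr pair => /=; rewrite !mulrDl //.
by rewrite !addrA; congr (_ + _); rewrite -!addrA; congr (_ + _); rewrite addrC.
Qed.
Fact dual_neq0 : one != 0.
Proof. by apply/eqP => -[] /eqP; rewrite oner_eq0. Qed.
HB.instance Definition _ := GRing.Zmodule_isComNzRing.Build D
  dual_mulA dual_mulC dual_mul1 dual_mulDl dual_neq0.
Fact dual_scaleAl (a : L) (x y : D) : a *: (x * y) = a *: x * y.
Proof.
case: x y => [x x'] [y y']; congr pair; rewrite /= /GRing.scale /= ?mulrA //.
by rewrite mulrDr !mulrA.
Qed.
HB.instance Definition _ := GRing.Lmodule_isLalgebra.Build L D dual_scaleAl.
Fact dual_scaleAr (a : L) (x y : D) : a *: (x * y) = x * (a *: y).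
Proof. by rewrite mulrC dual_scaleAl mulrC. Qed.
HB.instance Definition _ := GRing.Lalgebra_isAlgebra.Build L D dual_scaleAr.

Definition dual_eval (x : D) : L^o := x.1.
Fact dual_eval_linear : linear dual_eval. Proof. by []. Qed.
HB.instance Definition _ := GRing.isLinear.Build L D L^o _ dual_eval
  dual_eval_linear.
Fact dual_eval_mul : monoid_morphism dual_eval. Proof. by []. Qed.
HB.instance Definition _ := GRing.isMonoidMorphism.Build D L^o dual_eval
  dual_eval_mul.

Definition dual_scale (c : L) (x : D) : D := (x.1, c * x.2).
Fact dual_scale_linear c : linear (dual_scale c).
Proof.
move=> a [x x'] [y y']; congr pair.
by rewrite /= /GRing.scale /= mulrDr mulrCA.
Qed.
HB.instance Definition _ c := GRing.isLinear.Build L D D _ (dual_scale c)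
  (dual_scale_linear c).
Fact dual_scale_mul c : monoid_morphism (dual_scale c).
Proof.
split=> [|[x x'] [y y']]; first by rewrite /dual_scale /= mulr0.
rewrite /dual_scale; apply/eqP; rewrite xpair_eqE; apply/andP; split=> //=.
by rewrite mulrDr mulrCA !mulrA.
Qed.
HB.instance Definition _ c := GRing.isMonoidMorphism.Build D D (dual_scale c)
  (dual_scale_mul c).
End Dual.

Section VectorSpaceSchemes.
Variables (Fq L : fieldType) (iL : {rmorphism Fq -> L}).

(* Schemes in Fq-vector spaces over L, by their functors of points. *)
Record vs_functor := VsFunctor {
  (* nonzero L-algebras suffice, the points over the zero ring being trivial *)
  pts : comAlgType L -> lmodType Fq;
  pmap : forall R S : comAlgType L, {lrmorphism R -> S} -> {linear pts R -> pts S};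
  pmap_id : forall (R : comAlgType L) (u : {lrmorphism R -> R}),
    u =1 id -> pmap u =1 id;
  pmap_comp : forall (R S T : comAlgType L) (u : {lrmorphism R -> S})
    (v : {lrmorphism S -> T}) (w : {lrmorphism R -> T}),
    w =1 v \o u -> pmap w =1 pmap v \o pmap u }.

(* E is isomorphic to Ga^d over L, as a functor in Fq-vector spaces. *)
Definition iso_Ga (d : nat) (E : vs_functor) : Prop :=
  exists theta : forall R : comAlgType L, pts E R -> 'rV[R]_d,
    [/\ forall R, bijective (theta R),
        forall (R : comAlgType L) x y, theta R (x + y) = theta R x + theta R y,
        forall (R : comAlgType L) (c : Fq) x,
          theta R (c *: x) = ((iL c)%:A : R) *: theta R x
      & forall (R S : comAlgType L) (u : {lrmorphism R -> S}) x,
          theta S (pmap E u x) = map_mx u (theta R x)].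

Record vs_end (E : vs_functor) := VsEnd {
  eapp :> forall R : comAlgType L, {linear pts E R -> pts E R};
  eapp_nat : forall (R S : comAlgType L) (u : {lrmorphism R -> S}) x,
    eapp S (pmap E u x) = pmap E u (eapp R x) }.

Definition Lie (E : vs_functor) (x : pts E (dual L)) : Prop :=
  pmap E (@dual_eval L) x = 0.

(* The action of the scalar c of L on Lie E. *)
Definition Lie_scale (E : vs_functor) (c : L) :
    pts E (dual L) -> pts E (dual L) := pmap E (dual_scale c).

End VectorSpaceSchemes.

(* Only a ring morphism A -> End(E) is required, as opposed to a morphism of *)
(* Fq-algebras.                                                             *)
Record anderson_module (Fq L : fieldType) (iL : {rmorphism Fq -> L})
    (A : comAlgType Fq) (l : {rmorphism A -> L}) (d : nat) := AndersonModule {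
  am_sch : vs_functor Fq L;
  am_iso : iso_Ga iL d am_sch;
  am_phi : A -> vs_end am_sch;
  am_phi1 : forall R x, am_phi 1 R x = x;
  am_phiD : forall a b R x, am_phi (a + b) R x = am_phi a R x + am_phi b R x;
  am_phiM : forall a b R x, am_phi (a * b) R x = am_phi a R (am_phi b R x);
  am_nil : forall a, exists n : nat, forall x, Lie x ->
    iter n (fun y => am_phi a (dual L) y - Lie_scale (l a) y) x = 0 }.

(* Fq-vector spaces with a ring morphism A -> End_Fq(V). *)
Record fq_module (Fq : fieldType) (A : comAlgType Fq) := FqModule {
  fqm_sort :> lmodType Fq;
  fqm_act : A -> {linear fqm_sort -> fqm_sort};
  fqm_act1 : forall x, fqm_act 1 x = x;
  fqm_actD : forall a b x, fqm_act (a + b) x = fqm_act a x + fqm_act b x;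
  fqm_actM : forall a b x, fqm_act (a * b) x = fqm_act a (fqm_act b x) }.

Definition am_points (Fq L : fieldType) (iL : {rmorphism Fq -> L})
    (A : comAlgType Fq) (l : {rmorphism A -> L}) (d : nat)
    (E : anderson_module iL l d) (R : comAlgType L) : fq_module A :=
  @FqModule Fq A (pts (am_sch E) R) (fun a => am_phi E a R)
    (@am_phi1 _ _ _ _ _ _ E R) (fun a b => @am_phiD _ _ _ _ _ _ E a b R)
    (fun a b => @am_phiM _ _ _ _ _ _ E a b R).

(* Tensor products: formal sums of pairs, two sums being identified when all *)
(* bilinear maps agree on them; tens_lift and tens_lift_uniq give the       *)
(* universal property.                                                      *)

Section Tensor.
Variables (R : comNzRingType) (M N : lmodType R).

Definition bilin (P : lmodType R) (f : M -> N -> P) : Prop :=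
  (forall y, linear (f^~ y)) /\ (forall x, linear (f x)).

Definition bsum (P : lmodType R) (f : M -> N -> P) (s : seq (M * N)) : P :=
  \sum_(z <- s) f z.1 z.2.

Definition tens_eq (s t : seq (M * N)) : bool :=
  `[< forall (P : lmodType R) (f : M -> N -> P), bilin f -> bsum f s = bsum f t >].

Fact tens_eq_equiv : equiv_class_of tens_eq.
Proof.
split=> [s|s t|t s u]; first exact/asboolP.
  by apply/asboolP/asboolP => H P f bf; rewrite H.
by move=> /asboolP H1 /asboolP H2; apply/asboolP => P f bf; rewrite H1 // H2.
Qed.
Canonical tens_equiv := EquivRelPack tens_eq_equiv.
Canonical tens_encModRel := defaultEncModRel tens_eq.

Definition tensor := {eq_quot tens_eq}.
HB.instance Definition _ : EqQuotient _ tens_eq tensor := EqQuotient.on tensor.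
HB.instance Definition _ := Choice.on tensor.

Definition tens (x : M) (y : N) : tensor := \pi_tensor [:: (x, y)].

Lemma tensP (s t : seq (M * N)) :
  (forall (P : lmodType R) (f : M -> N -> P), bilin f -> bsum f s = bsum f t) ->
  \pi_tensor s = \pi_tensor t.
Proof. by move=> H; apply/eqP; rewrite piE; apply/asboolP. Qed.

Definition tens_eval (P : lmodType R) (f : M -> N -> P) (t : tensor) : P :=
  bsum f (repr t).

Lemma tens_evalE (P : lmodType R) (f : M -> N -> P) s : bilin f ->
  tens_eval f (\pi_tensor s) = bsum f s.
Proof.
move=> bf; have /eqP : \pi_tensor (repr (\pi_tensor s)) = \pi_tensor s.
  by rewrite reprK.
by rewrite piE => /asboolP; apply.
Qed.

Lemma tens_ext (t u : tensor) :
  (forall (P : lmodType R) (f : M -> N -> P), bilin f ->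
     tens_eval f t = tens_eval f u) -> t = u.
Proof. by move=> H; rewrite -[t]reprK -[u]reprK; apply: tensP => P f /H. Qed.

Let tzero : tensor := \pi_tensor [::].
Let tadd (t u : tensor) : tensor := \pi_tensor (repr t ++ repr u).
Let tscale (a : R) (t : tensor) : tensor :=
  \pi_tensor [seq (a *: z.1, z.2) | z <- repr t].
Let topp (t : tensor) : tensor := tscale (-1) t.

Let eval0 (P : lmodType R) (f : M -> N -> P) : bilin f -> tens_eval f tzero = 0.
Proof. by move=> bf; rewrite tens_evalE // /bsum big_nil. Qed.
Let evalD (P : lmodType R) (f : M -> N -> P) t u : bilin f ->
  tens_eval f (tadd t u) = tens_eval f t + tens_eval f u.
Proof. by move=> bf; rewrite tens_evalE // /bsum big_cat. Qed.
Let evalZ (P : lmodType R) (f : M -> N -> P) a t : bilin f ->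
  tens_eval f (tscale a t) = a *: tens_eval f t.
Proof.
move=> bf; rewrite tens_evalE // /bsum big_map scaler_sumr.
apply: eq_bigr => -[x y] _ /=; have := bf.1 y a x 0.
rewrite addr0 => ->; suff -> : f 0 y = 0 by rewrite addr0.
by have := bf.1 y (-1) 0 0; rewrite scaler0 addr0 scaleN1r addNr.
Qed.

Fact tens_addA : associative tadd.
Proof. by move=> t u v; apply: tens_ext => P f bf; rewrite !evalD // addrA. Qed.
Fact tens_addC : commutative tadd.
Proof. by move=> t u; apply: tens_ext => P f bf; rewrite !evalD // addrC. Qed.
Fact tens_add0 : left_id tzero tadd.
Proof. by move=> t; apply: tens_ext => P f bf; rewrite evalD // eval0 // add0r. Qed.
Fact tens_addN : left_inverse tzero topp tadd.
Proof.
move=> t; apply: tens_ext => P f bf; rewrite evalD // evalZ // eval0 //.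
by rewrite scaleN1r addNr.
Qed.
HB.instance Definition _ := GRing.isZmodule.Build tensor
  tens_addA tens_addC tens_add0 tens_addN.

Fact tens_scaleA a b t : tscale a (tscale b t) = tscale (a * b) t.
Proof. by apply: tens_ext => P f bf; rewrite !evalZ // scalerA. Qed.
Fact tens_scale1 : left_id 1 tscale.
Proof. by move=> t; apply: tens_ext => P f bf; rewrite evalZ // scale1r. Qed.
Fact tens_scaleDr : right_distributive tscale +%R.
Proof.
move=> a t u; apply: tens_ext => P f bf.
by rewrite [_ + _ in RHS]/(tadd _ _) !(evalZ, evalD) // scalerDr.
Qed.
Fact tens_scaleDl t : {morph tscale^~ t : a b / a + b}.
Proof.
move=> a b; apply: tens_ext => P f bf.
by rewrite [_ + _ in RHS]/(tadd _ _) !(evalZ, evalD) // scalerDl.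
Qed.
HB.instance Definition _ := GRing.Zmodule_isLmodule.Build R tensor
  tens_scaleA tens_scale1 tens_scaleDr tens_scaleDl.

Lemma tens_bilin : bilin tens.
Proof.
split=> z a x y; apply: tens_ext => P f bf;
  rewrite [a *: _ + _ in RHS]/(tadd (tscale _ _) _) evalD // evalZ //;
  rewrite !tens_evalE // /bsum !big_seq1 /=;
  [exact: bf.1 | exact: bf.2].
Qed.

Lemma tens_eval_linear (P : lmodType R) (f : M -> N -> P) : bilin f ->
  linear (tens_eval f).
Proof. by move=> bf a t u; rewrite evalD // evalZ. Qed.

Definition tens_lift (P : lmodType R) (f : M -> N -> P) (bf : bilin f)
  (t : tensor) : P := tens_eval f t.
HB.instance Definition _ (P : lmodType R) (f : M -> N -> P) (bf : bilin f) :=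
  GRing.isLinear.Build R tensor P _ (tens_lift bf) (tens_eval_linear bf).
Lemma tens_liftE (P : lmodType R) (f : M -> N -> P) (bf : bilin f) x y :
  tens_lift bf (tens x y) = f x y.
Proof. by rewrite /tens_lift tens_evalE // /bsum big_seq1. Qed.
Lemma tens_lift_uniq (P : lmodType R) (f : M -> N -> P) (bf : bilin f)
    (g : {linear tensor -> P}) :
  (forall x y, g (tens x y) = f x y) -> g =1 tens_lift bf.
Proof.
move=> gE t; rewrite /tens_lift /tens_eval -{1}[t]reprK.
elim: (repr t) => [|[x y] s IHs].
  by rewrite /bsum big_nil [\pi _](_ : _ = 0) ?raddf0.
have -> : \pi_tensor ((x, y) :: s) = tens x y + \pi_tensor s.
  apply: tens_ext => Q h bh; rewrite [_ + _]/(tadd _ _) evalD //.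
  by rewrite !tens_evalE // /bsum big_cons big_seq1.
by rewrite [LHS]linearD [X in X + _]gE IHs /bsum big_cons.
Qed.
End Tensor.

Section TensorMap.
Variables (R : comNzRingType) (M M' N N' : lmodType R).
Variables (f : {linear M -> M'}) (g : {linear N -> N'}).
Fact tmap_bilin : bilin (fun x y => tens (f x) (g y)).
Proof.
split=> z a x y /=; first by rewrite linearP (tens_bilin _ _).1.
by rewrite linearP (tens_bilin _ _).2.
Qed.
Definition tmap : tensor M N -> tensor M' N' := tens_lift tmap_bilin.
Fact tmap_linear : linear tmap. Proof. exact: linearP. Qed.
HB.instance Definition _ := GRing.isLinear.Build R (tensor M N) (tensor M' N') _
  tmap tmap_linear.
Lemma tmapE x y : tmap (tens x y) = tens (f x) (g y).
Proof. exact: tens_liftE. Qed.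
End TensorMap.
Arguments tmap {R M M' N N'} f g : simpl never.

Lemma tens_ind (R : comNzRingType) (M N P : lmodType R)
  (g h : {linear tensor M N -> P}) :
  (forall x y, g (tens x y) = h (tens x y)) -> g =1 h.
Proof.
move=> gh t; have bh : bilin (fun x y => h (tens x y)).
  by split=> z a x y; rewrite ?(tens_bilin _ _).1 ?(tens_bilin _ _).2 linearP.
by rewrite (tens_lift_uniq bh gh) -(tens_lift_uniq bh (g := h)).
Qed.


Section InverseLimit.
Variables (X : nat -> zmodType) (t : forall n, {additive X n.+1 -> X n}).
Record ilim := ILim {
  icomp :> forall n, X n;
  icoh : forall n, t n (icomp n.+1) = icomp n }.
HB.instance Definition _ := gen_eqMixin ilim.
HB.instance Definition _ := gen_choiceMixin ilim.
Lemma ilimP (x y : ilim) : (forall n, x n = y n) -> x = y.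
Proof.
case: x y => [x hx] [y hy] /= xy.
have {}xy : x = y by apply: functional_extensionality_dep.
by subst y; congr ILim; apply: Prop_irrelevance.
Qed.
Program Definition ilim0 := @ILim (fun=> 0) _.
Next Obligation. by move=> n; rewrite raddf0. Qed.
Program Definition ilimN (x : ilim) := @ILim (fun n => - x n) _.
Next Obligation. by move=> x n /=; rewrite raddfN /= icoh. Qed.
Program Definition ilimD (x y : ilim) := @ILim (fun n => x n + y n) _.
Next Obligation. by move=> x y n /=; rewrite raddfD /= !icoh. Qed.
Fact ilim_addA : associative ilimD.
Proof. by move=> x y z; apply: ilimP => n /=; rewrite addrA. Qed.
Fact ilim_addC : commutative ilimD.
Proof. by move=> x y; apply: ilimP => n /=; rewrite addrC. Qed.
Fact ilim_add0 : left_id ilim0 ilimD.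
Proof. by move=> x; apply: ilimP => n /=; rewrite add0r. Qed.
Fact ilim_addN : left_inverse ilim0 ilimN ilimD.
Proof. by move=> x; apply: ilimP => n /=; rewrite addNr. Qed.
HB.instance Definition _ := GRing.isZmodule.Build ilim
  ilim_addA ilim_addC ilim_add0 ilim_addN.
End InverseLimit.
Arguments ILim : clear implicits.


Section Powers.
Variables (A : comNzRingType) (p : idealr A).

Fixpoint ideal_pow (n : nat) : A -> Prop :=
  if n is m.+1 then fun x => exists s : seq (A * A),
    (forall z, z \in s -> z.1 \in p /\ ideal_pow m z.2)
    /\ x = \sum_(z <- s) z.1 * z.2
  else fun=> True.

Definition powS (n : nat) : A -> bool := fun x => `[< ideal_pow n.+1 x >].

Fact powS_idealr n : idealr_closed (powS n).
Proof.
split.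
- by apply/asboolP; exists [::]; split=> //; rewrite big_nil.
- apply/negP => /asboolP[s [sp /eqP]]; apply/negP.
  apply/eqP => e1; have := idealr1 p; rewrite e1 big_seq rpred_sum //.
  by move=> z /sp[zp _]; rewrite mulrC idealMr.
- move=> a u v /asboolP[s [sp ->]] /asboolP[s' [sp' ->]]; apply/asboolP.
  exists ([seq (a * z.1, z.2) | z <- s] ++ s'); split.
    move=> z; rewrite mem_cat => /orP[/mapP[y /sp[yp yn] ->]|/sp' //].
    by split=> //=; apply: idealMr.
  rewrite big_cat big_map /= mulr_sumr; congr (_ + _).
  by apply: eq_bigr => z _; rewrite mulrA.
Qed.
HB.instance Definition _ n := isIdealr.Build A (powS n) (powS_idealr n).
Definition powI (n : nat) : idealr A := powS n.

Lemma powSW n x : x \in powS n.+1 -> x \in powS n.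
Proof.
suff H m y : ideal_pow m.+1 y -> ideal_pow m y.
  by move=> /asboolP/H xn; apply/asboolP.
elim: m y => [//|m IHm] y [s [sp ->]]; exists s; split=> // z /sp[? ?].
by split=> //; apply: IHm.
Qed.
End Powers.

Section Adic.
Variables (Fq : fieldType) (A : comAlgType Fq) (p : prime_idealr A).

Definition Aq (n : nat) : Type := {ideal_quot (powI p n)}.
HB.instance Definition _ n := GRing.ComNzRing.on (Aq n).
Definition toAq (n : nat) (a : A) : Aq n := \pi_{ideal_quot (powI p n)} a.

Fact toAq_zmod n : zmod_morphism (toAq n).
Proof. exact: raddfB. Qed.
HB.instance Definition _ n := GRing.isZmodMorphism.Build A (Aq n) (toAq n)
  (@toAq_zmod n).
Fact toAq_mul n : monoid_morphism (toAq n).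
Proof. exact: pi_is_monoid_morphism. Qed.
HB.instance Definition _ n := GRing.isMonoidMorphism.Build A (Aq n) (toAq n)
  (@toAq_mul n).


Lemma toAq_surj n (x : Aq n) : exists a, toAq n a = x.
Proof. by exists (repr x); rewrite /toAq reprK. Qed.
Lemma toAq_eq0 n a : (toAq n a == 0) = (a \in powS p n).
Proof. by rewrite -[0](raddf0 (toAq n)) piE /= /Quotient.equiv subr0. Qed.

Let qscale n (c : Fq) (x : Aq n) : Aq n := toAq n c%:A * x.
Fact Aq_scaleA n a b (x : Aq n) : qscale a (qscale b x) = qscale (a * b) x.
Proof. by rewrite /qscale mulrA -rmorphM /= -scalerAl mul1r scalerA. Qed.
Fact Aq_scale1 n : left_id 1 (@qscale n).
Proof. by move=> x; rewrite /qscale scale1r rmorph1 mul1r. Qed.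
Fact Aq_scaleDr n : right_distributive (@qscale n) +%R.
Proof. by move=> a x y; rewrite /qscale mulrDr. Qed.
Fact Aq_scaleDl n v : {morph (@qscale n)^~ v : a b / a + b}.
Proof. by move=> a b; rewrite /qscale scalerDl rmorphD mulrDl. Qed.
HB.instance Definition _ n := GRing.Zmodule_isLmodule.Build Fq (Aq n)
  (@Aq_scaleA n) (@Aq_scale1 n) (@Aq_scaleDr n) (@Aq_scaleDl n).
Lemma Aq_scaleE n (c : Fq) (x : Aq n) : c *: x = toAq n c%:A * x.
Proof. by []. Qed.

Definition redAq (n : nat) (x : Aq n.+1) : Aq n := toAq n (repr x).
Lemma redAqE n a : redAq (toAq n.+1 a) = toAq n a.
Proof.
apply/eqP; rewrite -subr_eq0 -raddfB /= toAq_eq0; apply: powSW.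
by rewrite -toAq_eq0 raddfB /= {1}/toAq reprK subrr.
Qed.
Fact redAq_mul n : monoid_morphism (@redAq n).
Proof.
split=> [|x y]; first by rewrite -(rmorph1 (toAq n.+1)) redAqE rmorph1.
case: (toAq_surj x) (toAq_surj y) => a <- [b <-].
by rewrite -rmorphM !redAqE rmorphM.
Qed.
Fact redAq_linear n : linear (@redAq n).
Proof.
move=> c x y; case: (toAq_surj x) (toAq_surj y) => a <- [b <-].
by rewrite !Aq_scaleE -rmorphM -rmorphD !redAqE rmorphD rmorphM.
Qed.
HB.instance Definition _ n := GRing.isLinear.Build Fq (Aq n.+1) (Aq n) _
  (@redAq n) (@redAq_linear n).
HB.instance Definition _ n := GRing.isMonoidMorphism.Build (Aq n.+1) (Aq n)
  (@redAq n) (@redAq_mul n).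

(* A_p, the inverse limit of the rings A / p^(n+1) *)
Definition Ap : Type := ilim (fun n => @redAq n).
HB.instance Definition _ := GRing.Zmodule.on Ap.

Program Definition Ap1 : Ap := ILim _ (fun n => @redAq n) (fun=> 1) _.
Next Obligation. by move=> n; exact: (rmorph1 (@redAq n)). Qed.
Program Definition ApM (x y : Ap) : Ap :=
  ILim _ (fun n => @redAq n) (fun n => (x n : Aq n) * y n) _.
Next Obligation.
move=> x y n /=; rewrite [LHS](rmorphM (@redAq n)) /=.
by rewrite [redAq _](icoh x) [redAq _](icoh y).
Qed.
Fact Ap_mulA : associative ApM.
Proof. by move=> x y z; apply: ilimP => n /=; rewrite mulrA. Qed.
Fact Ap_mulC : commutative ApM.
Proof. by move=> x y; apply: ilimP => n /=; rewrite mulrC. Qed.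
Fact Ap_mul1 : left_id Ap1 ApM.
Proof. by move=> x; apply: ilimP => n /=; rewrite mul1r. Qed.
Fact Ap_mulDl : left_distributive ApM +%R.
Proof. by move=> x y z; apply: ilimP => n /=; rewrite mulrDl. Qed.
Fact Ap_neq0 : Ap1 != 0.
Proof.
apply/eqP => /(congr1 (fun x : Ap => (x 0%N : Aq 0))) /eqP.
by rewrite oner_eq0.
Qed.
HB.instance Definition _ := GRing.Zmodule_isComNzRing.Build Ap
  Ap_mulA Ap_mulC Ap_mul1 Ap_mulDl Ap_neq0.

Program Definition toAp (a : A) : Ap :=
  ILim _ (fun n => @redAq n) (fun n => toAq n a) _.
Next Obligation. by move=> a n /=; rewrite redAqE. Qed.
Fact toAp_zmod : zmod_morphism toAp.
Proof. by move=> a b; apply: ilimP => n /=; rewrite raddfB. Qed.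
HB.instance Definition _ := GRing.isZmodMorphism.Build A Ap toAp toAp_zmod.
Fact toAp_mul : monoid_morphism toAp.
Proof.
by split=> [|a b]; apply: ilimP => n /=; rewrite ?rmorph1 ?rmorphM.
Qed.
HB.instance Definition _ := GRing.isMonoidMorphism.Build A Ap toAp toAp_mul.

(* A uniformizer: a nonzero generator of the maximal ideal of A_p. *)
Definition uniformizer (pi : A) : Prop :=
  toAp pi <> 0 /\
  forall b : Ap, (b 0%N : Aq 0) = 0 <-> exists c, b = toAp pi * c.

End Adic.


Section AdicTensor.
Variables (Fq : fieldType) (A : comAlgType Fq) (p : prime_idealr A).
Variable V : fq_module A.
Local Notation Aq := (Aq p).
Local Notation Ap := (Ap p).

Section MulAq.
Variables (n : nat) (b : Aq n).
Definition mulAq (x : Aq n) : Aq n := b * x.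
Fact mulAq_linear : linear mulAq.
Proof. by move=> c x y; rewrite /mulAq mulrDr !Aq_scaleE mulrCA. Qed.
HB.instance Definition _ := GRing.isLinear.Build Fq (Aq n) (Aq n) _ mulAq
  mulAq_linear.
End MulAq.

Local Notation tred n := (tmap (@redAq _ _ p n) (idfun : V -> V)).
Local Notation tmul b := (tmap (mulAq b) (idfun : V -> V)).
Local Notation tact n a := (tmap (idfun : Aq n -> Aq n) (fqm_act V a)).

(* E((A (x) C_oo)_p), for V = E(C_oo) *)
Definition ptensor : Type := @ilim (fun n => tensor (Aq n) V) (fun n => tred n).
HB.instance Definition _ := GRing.Zmodule.on ptensor.
Local Notation PT := (ILim (fun n => tensor (Aq n) V) (fun n => tred n)).

(* The action of A_p through the first factor. *)
Program Definition pt_scale (b : Ap) (h : ptensor) : ptensor :=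
  PT (fun n => tmul (b n) (h n)) _.
Next Obligation.
move=> b h n /=; rewrite -[in RHS](icoh h).
pose g1 := (tred n \o tmul (b n.+1)); pose g2 := (tmul (b n) \o tred n).
apply: (@tens_ind _ _ _ _ g1 g2) => x y.
rewrite /g1 /g2 /= !tmapE /= /mulAq [redAq _](rmorphM (@redAq _ _ p n)) /=.
by rewrite [redAq (b _)](icoh b).
Qed.

(* The action of phi_a on the second factor. *)
Program Definition pt_act (a : A) (h : ptensor) : ptensor :=
  PT (fun n => tact n a (h n)) _.
Next Obligation.
move=> a h n /=; rewrite -[in RHS](icoh h).
pose g1 := (tred n \o tact n.+1 a); pose g2 := (tact n a \o tred n).
by apply: (@tens_ind _ _ _ _ g1 g2) => x y; rewrite /g1 /g2 /= !tmapE.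
Qed.

Fact pt_scaleA a b h : pt_scale a (pt_scale b h) = pt_scale (a * b) h.
Proof.
apply: ilimP => n /=.
apply: (@tens_ind _ _ _ _ (tmul (a n) \o tmul (b n)) (tmul _)) => x y.
by rewrite /= !tmapE /= /mulAq mulrA.
Qed.
Fact pt_scale1 : left_id 1 pt_scale.
Proof.
move=> h; apply: ilimP => n /=.
apply: (@tens_ind _ _ _ _ (tmul _) idfun) => x y.
by rewrite /= tmapE /= /mulAq mul1r.
Qed.
Fact pt_scaleDr : right_distributive pt_scale +%R.
Proof. by move=> a x y; apply: ilimP => n /=; rewrite raddfD. Qed.
Fact pt_scaleDl h : {morph pt_scale^~ h : a b / a + b}.
Proof.
move=> a b; apply: ilimP => n /=.
apply: (@tens_ind _ _ _ _ (tmul _) (tmul (a n) \+ tmul (b n))) => x y.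
rewrite /= !tmapE /= /mulAq mulrDl.
by have := (tens_bilin _ _).1 y 1 (a n * x) (b n * x); rewrite !scale1r.
Qed.
HB.instance Definition _ := GRing.Zmodule_isLmodule.Build Ap ptensor
  pt_scaleA pt_scale1 pt_scaleDr pt_scaleDl.

Fact pt_act_linear a : linear (pt_act a).
Proof.
move=> b x y; apply: ilimP => n /=; rewrite raddfD /=; congr (_ + _).
apply: (@tens_ind _ _ _ _ (tact n a \o tmul (b n)) (tmul (b n) \o tact n a)).
by move=> u v; rewrite /= !tmapE.
Qed.
HB.instance Definition _ a := GRing.isLinear.Build Ap ptensor ptensor _
  (pt_act a) (pt_act_linear a).

Lemma pt_actC a b h : pt_act a (pt_act b h) = pt_act b (pt_act a h).
Proof.
apply: ilimP => n /=.
apply: (@tens_ind _ _ _ _ (tact n a \o tact n b) (tact n b \o tact n a)).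
by move=> u v; rewrite /= !tmapE /= -!fqm_actM mulrC.
Qed.

Definition Hhat_pred (h : ptensor) : bool :=
  `[< forall a, pt_act a h = toAp p a *: h >].
Fact Hhat_submod : submod_closed Hhat_pred.
Proof.
split=> [|b x y /asboolP hx /asboolP hy]; apply/asboolP => a.
  by rewrite raddf0 scaler0.
by rewrite linearP /= hx hy scalerDr !scalerA mulrC.
Qed.
HB.instance Definition _ := GRing.isSubmodClosed.Build Ap ptensor Hhat_pred
  Hhat_submod.
Definition Hhat : Type := {h : ptensor | Hhat_pred h}.
HB.instance Definition _ := SubChoice.on Hhat.
HB.instance Definition _ := [SubChoice_isSubLmodule of Hhat by <:].
Definition Hincl : Hhat -> ptensor := val.
HB.instance Definition _ := GRing.Linear.on Hincl.

Fact Hhat_act_subproof a (h : Hhat) : Hhat_pred (pt_act a (Hincl h)).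
Proof.
apply/asboolP => b; have /asboolP hh := valP h.
by rewrite pt_actC [in LHS]hh linearZ.
Qed.
Definition Hhat_act a (h : Hhat) : Hhat := Sub _ (Hhat_act_subproof a h).
Fact Hhat_act_linear a : linear (Hhat_act a).
Proof. by move=> b x y; apply: val_inj; rewrite /= !linearP. Qed.
HB.instance Definition _ a := GRing.isLinear.Build Ap Hhat Hhat _
  (Hhat_act a) (Hhat_act_linear a).

End AdicTensor.

Definition fraction_field (R : comNzRingType) (F : fieldType)
    (k : {rmorphism R -> F}) : Prop :=
  injective k /\ forall y, exists a b, b != 0 /\ y = k a / k b.

Section FractionQuotient.
Variables (R : comNzRingType) (F : fieldType) (k : {rmorphism R -> F}).

Definition frange : {pred F} := fun y : F => `[< exists a, k a = y >].
Fact frange_zmod : zmod_closed frange.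
Proof.
split=> [|x y /asboolP[a <-] /asboolP[b <-]]; apply/asboolP.
  by exists 0; rewrite rmorph0.
by exists (a - b); rewrite rmorphB.
Qed.
HB.instance Definition _ := GRing.isZmodClosed.Build F frange frange_zmod.
Definition frangeI : zmodClosed F := frange.

(* F / R, as an R-module *)
Definition fquot : Type := {ideal_quot frangeI}.
HB.instance Definition _ := GRing.Zmodule.on fquot.
Definition fclass (y : F) : fquot := \pi_{ideal_quot frangeI} y.
Fact fclass_zmod : zmod_morphism fclass.
Proof. exact: raddfB. Qed.
HB.instance Definition _ := GRing.isZmodMorphism.Build F fquot fclass fclass_zmod.
Lemma fclass_surj (x : fquot) : exists y, fclass y = x.
Proof. by exists (repr x); rewrite /fclass reprK. Qed.
Lemma fclass_eq0 y : (fclass y == 0) = frange y.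
Proof. by rewrite -[0](raddf0 fclass) piE /= /Quotient.equiv subr0. Qed.

Definition fscale (a : R) (x : fquot) : fquot := fclass (k a * repr x).
Lemma fscaleE a y : fscale a (fclass y) = fclass (k a * y).
Proof.
apply/eqP; rewrite -subr_eq0 -raddfB /= fclass_eq0 -mulrBr.
have : frange (repr (fclass y) - y).
  by rewrite -fclass_eq0 raddfB /= {1}/fclass reprK subrr.
move=> /asboolP[b <-]; apply/asboolP; exists (a * b); exact: rmorphM.
Qed.
Fact fscaleA a b x : fscale a (fscale b x) = fscale (a * b) x.
Proof. by case: (fclass_surj x) => y <-; rewrite !fscaleE rmorphM mulrA. Qed.
Fact fscale1 : left_id 1 fscale.
Proof. by move=> x; case: (fclass_surj x) => y <-; rewrite fscaleE rmorph1 mul1r. Qed.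
Fact fscaleDr : right_distributive fscale +%R.
Proof.
move=> a x y; case: (fclass_surj x) (fclass_surj y) => u <- [v <-].
by rewrite -raddfD !fscaleE -raddfD mulrDr.
Qed.
Fact fscaleDl x : {morph fscale^~ x : a b / a + b}.
Proof.
move=> a b; case: (fclass_surj x) => u <-.
by rewrite !fscaleE -raddfD rmorphD mulrDl.
Qed.
HB.instance Definition _ := GRing.Zmodule_isLmodule.Build R fquot
  fscaleA fscale1 fscaleDr fscaleDl.
End FractionQuotient.

(* Hom_Z(Q, W), where R acts through Q. *)
Section HomZ.
Variables (R : comNzRingType) (Q : lmodType R) (W : zmodType).
Record homz := HomZ { hfun :> Q -> W; hfunB : zmod_morphism hfun }.
HB.instance Definition _ := gen_eqMixin homz.
HB.instance Definition _ := gen_choiceMixin homz.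
HB.instance Definition _ (f : homz) :=
  GRing.isZmodMorphism.Build Q W (hfun f) (hfunB f).
Lemma homzP (f g : homz) : f =1 g -> f = g.
Proof.
case: f g => [f hf] [g hg] /= fg; have {}fg : f = g by apply: funext.
by subst g; congr HomZ; apply: Prop_irrelevance.
Qed.
Program Definition homz0 := @HomZ (fun=> 0) _.
Next Obligation. by move=> x y; rewrite subrr. Qed.
Program Definition homzN (f : homz) := @HomZ (fun x => - f x) _.
Next Obligation. by move=> f x y; rewrite raddfB opprD. Qed.
Program Definition homzD (f g : homz) := @HomZ (fun x => f x + g x) _.
Next Obligation. by move=> f g x y; rewrite !raddfB opprD addrACA. Qed.
Program Definition homzZ (a : R) (f : homz) := @HomZ (fun x => f (a *: x)) _.
Next Obligation. by move=> a f x y; rewrite scalerBr raddfB. Qed.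
Fact homz_addA : associative homzD.
Proof. by move=> f g h; apply: homzP => x /=; rewrite addrA. Qed.
Fact homz_addC : commutative homzD.
Proof. by move=> f g; apply: homzP => x /=; rewrite addrC. Qed.
Fact homz_add0 : left_id homz0 homzD.
Proof. by move=> f; apply: homzP => x /=; rewrite add0r. Qed.
Fact homz_addN : left_inverse homz0 homzN homzD.
Proof. by move=> f; apply: homzP => x /=; rewrite addNr. Qed.
HB.instance Definition _ := GRing.isZmodule.Build homz
  homz_addA homz_addC homz_add0 homz_addN.
Fact homz_scaleA a b f : homzZ a (homzZ b f) = homzZ (a * b) f.
Proof. by apply: homzP => x /=; rewrite scalerA mulrC. Qed.
Fact homz_scale1 : left_id 1 homzZ.
Proof. by move=> f; apply: homzP => x /=; rewrite scale1r. Qed.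
Fact homz_scaleDr : right_distributive homzZ +%R.
Proof. by move=> a f g; apply: homzP. Qed.
Fact homz_scaleDl f : {morph homzZ^~ f : a b / a + b}.
Proof. by move=> a b; apply: homzP => x /=; rewrite scalerDl raddfD. Qed.
HB.instance Definition _ := GRing.Zmodule_isLmodule.Build R homz
  homz_scaleA homz_scale1 homz_scaleDr homz_scaleDl.
End HomZ.

Section HomAct.
Variables (R : comNzRingType) (Q : lmodType R) (W W' : zmodType).
Variable u : {additive W -> W'}.
Program Definition homz_post (f : homz Q W) : homz Q W' :=
  @HomZ _ Q W' (fun x => u (f x)) _.
Next Obligation. by move=> f x y; rewrite !raddfB. Qed.
End HomAct.

Section Local.
Variables (Fq : fieldType) (A : comAlgType Fq) (p : prime_idealr A).
Local Notation Ap := (Ap p).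
Variable (Fp : fieldExtType Fq).

(* red exhibits Fp as A / p *)
Definition residue_field (red : {lrmorphism A -> Fp}) : Prop :=
  (forall c, exists a, red a = c) /\ forall a, red a = 0 <-> a \in p.

Definition is_section (red : {lrmorphism A -> Fp}) (s : {rmorphism Fp -> Ap}) :
  Prop := forall a, (s (red a) 0%N : Aq p 0) = toAq p 0 a.

(* The topology of an A_p-module is the p-adic one, given by the powers of  *)
(* the uniformizer pi.                                                      *)
Definition pi_congr (pi : A) (M : lmodType Ap) (n : nat) (x y : M) : Prop :=
  exists z, x - y = toAp p pi ^+ n *: z.

Definition complete_module (pi : A) (M : lmodType Ap) : Prop :=
  (forall x : M, (forall n, pi_congr pi n x 0) -> x = 0) /\
  forall u : nat -> M, (forall n, pi_congr pi n (u n.+1) (u n)) ->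
    exists l, forall n, pi_congr pi n (u n) l.

Definition derivation (s : {rmorphism Fp -> Ap}) (M : lmodType Ap)
    (D : Ap -> M) : Prop :=
  [/\ forall x y, D (x + y) = D x + D y,
      forall x y, D (x * y) = x *: D y + y *: D x
    & forall c, D (s c) = 0].

(* Omega is the module of continuous differentials of A_p over Fp: d is the *)
(* universal derivation to complete modules.  By the Leibniz rule, every    *)
(* derivation is continuous.                                                *)
Definition cont_differentials (pi : A) (s : {rmorphism Fp -> Ap})
    (Omega : lmodType Ap) (d : Ap -> Omega) : Prop :=
  [/\ derivation s d, complete_module pi Omega
    & forall (M : lmodType Ap) (D : Ap -> M),
        complete_module pi M -> derivation s D ->
        exists g : {linear Omega -> M}, (forall b, D b = g (d b)) /\
          forall g' : {linear Omega -> M}, (forall b, D b = g' (d b)) -> g' =1 g].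

(* res f is the coefficient of pi^-1 in f : K_p = Fp((pi)), that is, the    *)
(* residue of f dpi.                                                        *)
Definition residue (pi : A) (s : {rmorphism Fp -> Ap}) (Kp : fieldType)
    (k : {rmorphism Ap -> Kp}) (res : Kp -> Fp) : Prop :=
  forall (n : nat) (c : nat -> Fp) (b : Ap),
    res (\sum_(i < n.+1) k (s (c i)) / k (toAp p pi) ^+ i.+1 + k b) = c 0%N.

(* The trace of Fp over Fq: the trace of the multiplication by x. *)
Definition trFp (x : Fp) : Fq :=
  let e := vbasis {:Fp} in \tr (passmx.mxof e e (amull x)).

End Local.

Section Trace.
Variables (Fq : fieldType) (Fp : fieldExtType Fq) (V : lmodType Fq).
Fact trFp_linear (x y : Fp) c : trFp (c *: x + y) = c * trFp x + trFp y.
Proof. by rewrite /trFp [amull _]linearP [X in mxtrace X]passmx.mxof_linear [LHS]linearP. Qed.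
Fact tr_id_bilin : bilin (fun (c : Fp) (v : V) => trFp c *: v).
Proof.
split=> [v|c] a x y /=; first by rewrite trFp_linear scalerDl scalerA.
by rewrite scalerDr !scalerA mulrC.
Qed.
(* tr (x) id : Fp (x) V -> Fq (x) V = V *)
Definition tr_id : tensor Fp V -> V := tens_lift tr_id_bilin.
HB.instance Definition _ := GRing.Linear.on tr_id.
End Trace.


Section FormalSums.
Variables (Fq : fieldType) (A : comAlgType Fq) (p : prime_idealr A).
Variables (V : fq_module A) (B : nat -> seq A).

(* B n lists the lifts of a basis of p^n / p^(n+1).  Arbitrary lifts need not *)
(* span A, whence the third condition.                                      *)
Definition adapted_basis : Prop :=
  [/\ forall n (i : 'I_(size (B n))), ideal_pow p n (B n)`_i,
      forall n x, ideal_pow p n x ->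
        exists! c : {ffun 'I_(size (B n)) -> Fq},
          ideal_pow p n.+1 (x - \sum_i c i *: (B n)`_i),
      forall a, exists (N : nat) (c : forall n, 'I_(size (B n)) -> Fq),
        a = \sum_(n < N) \sum_(i < size (B n)) c n i *: (B n)`_i
    & forall (N : nat) (c : forall n, 'I_(size (B n)) -> Fq),
        \sum_(n < N) \sum_(i < size (B n)) c n i *: (B n)`_i = 0 ->
        forall n i, (n < N)%N -> c n i = 0].

(* h = \sum_(a in B) a (x) e_a; the terms of p^(N+1) vanish in A / p^(N+1). *)
Definition is_formal_sum (e : forall n, 'I_(size (B n)) -> V)
    (h : ptensor p V) : Prop :=
  forall N, h N = \sum_(n < N.+1) \sum_(i < size (B n))
                    tens (toAq p N (B n)`_i) (e n i).

(* s is the sum of the family w, of which finitely many terms are nonzero. *)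
Definition is_finite_sum (W : zmodType) (w : forall n, 'I_(size (B n)) -> W)
    (s : W) : Prop :=
  exists N, (forall n i, (N <= n)%N -> w n i = 0) /\
            s = \sum_(n < N) \sum_(i < size (B n)) w n i.

End FormalSums.


Section Homs.
Variables (Fq : fieldType) (A : comAlgType Fq) (p : prime_idealr A).
Variables (Fp : fieldExtType Fq) (s : {rmorphism Fp -> Ap p}).
Variables (Q : lmodType (Ap p)) (V : fq_module A).

Definition Fp_mul (c : Fp) (t : tensor Fp V) : tensor Fp V :=
  tmap (amull c) idfun t.
Definition FpV_act (a : A) : tensor Fp V -> tensor Fp V :=
  tmap idfun (fqm_act V a).
HB.instance Definition _ a := GRing.Linear.on (FpV_act a).

Definition Hom_Fp (f : homz Q (tensor Fp V)) : Prop :=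
  forall c x, f (s c *: x) = Fp_mul c (f x).
Definition Hom_FpA (f : homz Q (tensor Fp V)) : Prop :=
  Hom_Fp f /\ forall a x, f (toAp p a *: x) = FpV_act a (f x).
Definition Hom_Fq (f : homz Q V) : Prop :=
  forall c x, f (toAp p c%:A *: x) = c *: f x.
Definition Hom_A (f : homz Q V) : Prop :=
  forall a x, f (toAp p a *: x) = fqm_act V a (f x).
End Homs.

(* T_p(E) = Hom_A(K_p / A_p, E(C_oo)) for V = E(C_oo), as a subset of        *)
(* Hom_Z(K_p / A_p, E(C_oo))                                                *)
Definition tate_module (Fq : fieldType) (A : comAlgType Fq)
    (p : prime_idealr A) (Kp : fieldType) (k : {rmorphism Ap p -> Kp})
    (V : fq_module A) : homz (fquot k) V -> Prop := @Hom_A _ _ p _ V.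

(* f restricts to an R-linear bijection from the submodule X onto Y. *)
Definition iso_on (R : nzRingType) (M N : lmodType R) (X : M -> Prop)
    (Y : N -> Prop) (f : M -> N) : Prop :=
  [/\ linear f, forall x, X x -> Y (f x),
      forall x x', X x -> X x' -> f x = f x' -> x = x'
    & forall y, Y y -> exists2 x, X x & f x = y].

(* As above for R (x) A-modules, i.e. R-modules with a commuting A-action. *)
Definition biiso_on (A : Type) (R : nzRingType) (M N : lmodType R)
    (aM : A -> M -> M) (aN : A -> N -> N) (X : M -> Prop) (Y : N -> Prop)
    (f : M -> N) : Prop :=
  iso_on X Y f /\ forall a x, X x -> f (aM a x) = aN a (f x).

(* Main.v *)
From HB Require Import structures.
Require Import Defs.
From mathcomp Require Import all_boot all_order all_algebra all_field.
From mathcomp Require Import boolp ring.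
Set Implicit Arguments.
Unset Strict Implicit.
Unset Printing Implicit Defensive.
Import GRing.Theory.
Local Open Scope ring_scope.

(* A_p is a complete discrete valuation ring with a section s of its residue
   field, so each b in A_p has digits b = sum_i s(b_i) pi^i. Differentiating
   digit expansions formally gives the universal continuous derivation, hence
   Omega is free on d pi, and the residue of (b / pi^(n+1)) d pi is the digit
   b_n. In the same way an element h of the completed tensor product has digits
   h_n in F_p (x) V, and these are arbitrary; as the pi^(-n-1) form an
   F_p-basis of K_p / A_p, the pairing pi^(-n-1) |-> h_n is bijective onto
   Hom_Fp. The trace form of a finite field being nondegenerate, composing with
   the trace is bijective onto Hom_Fq. Finally, both isomorphisms are
   A-equivariant, so they restrict to the loci where the two A-actions agree.

   For an Anderson module, phi is only assumed to be a ring morphism, so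
   phi_c = c for c in F_q must be proved: psi = phi_c - c satisfies psi^q = psi
   and kills Lie E, so on coordinates it is given by additive polynomials
   divisible by X^2; iterating, they are divisible by all powers of X. *)

(** * Tensor products and inverse limits *)

Section TensorFacts.
Variables (R : comNzRingType) (M N : lmodType R).
Implicit Types (x : M) (y : N) (a : R).

Lemma tensDl x x' y : tens (x + x') y = tens x y + tens x' y.
Proof. by have := (tens_bilin M N).1 y 1 x x'; rewrite !scale1r. Qed.
Lemma tensZl a x y : tens (a *: x) y = a *: tens x y.
Proof.
have t0 : tens (0 : M) y = 0.
  by apply: (addIr (tens (0 : M) y)); rewrite -tensDl !add0r.
by have := (tens_bilin M N).1 y a x 0; rewrite !addr0 t0 addr0.
Qed.
Lemma tens0l y : tens (0 : M) y = 0.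
Proof. by rewrite -(scale0r (0 : M)) tensZl scale0r. Qed.
Lemma tensDr x y y' : tens x (y + y') = tens x y + tens x y'.
Proof. by have := (tens_bilin M N).2 x 1 y y'; rewrite !scale1r. Qed.
Lemma tensZr a x y : tens x (a *: y) = a *: tens x y.
Proof.
have t0 : tens x (0 : N) = 0.
  by apply: (addIr (tens x (0 : N))); rewrite -tensDr !add0r.
by have := (tens_bilin M N).2 x a y 0; rewrite !addr0 t0 addr0.
Qed.
Lemma tens_suml I (r : seq I) (P : pred I) (F : I -> M) y :
  tens (\sum_(i <- r | P i) F i) y = \sum_(i <- r | P i) tens (F i) y.
Proof.
by apply: (big_morph (fun x => tens x y)) => [u v|]; rewrite ?tensDl ?tens0l.
Qed.

(** Every tensor is the class of a list of pairs, hence a sum of pure tensors with no scalars left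
    over, so additivity of plain functions is enough to compare them. *)
Lemma tens_eqfun (P : zmodType) (f g : tensor M N -> P) :
  zmod_morphism f -> zmod_morphism g ->
  (forall x y, f (tens x y) = g (tens x y)) -> f =1 g.
Proof.
move=> fB gB fg t; rewrite -[t]reprK.
pose f' := HB.pack_for {additive tensor M N -> P} f
  (GRing.isZmodMorphism.Build _ _ f fB).
pose g' := HB.pack_for {additive tensor M N -> P} g
  (GRing.isZmodMorphism.Build _ _ g gB).
elim: (repr t) => [|[x y] s IHs].
  rewrite [\pi%qT _](_ : _ = (0 : tensor M N)) //.
  by rewrite -[LHS]/(f' 0) -[RHS]/(g' 0) !raddf0.
have -> : \pi_(tensor M N)%qT ((x, y) :: s) =
    tens x y + \pi_(tensor M N)%qT s.
  apply: tens_ext => Q h bh.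
  have := tens_eval_linear bh 1 (tens x y) (\pi_(tensor M N)%qT s).
  rewrite !scale1r => ->; rewrite !tens_evalE //.
  by rewrite /bsum big_cons big_seq1.
by rewrite -[LHS]/(f' _) -[RHS]/(g' _) !raddfD /= fg IHs.
Qed.
End TensorFacts.

(* A set-theoretic section of [r], corrected by [id - e], becomes linear; this
   splits the tensored sequence without any basis. *)
Lemma tmap_ker (R : comNzRingType) (M M' N : lmodType R)
    (r : {linear M -> M'}) (e : {linear M -> M}) :
  (forall y, exists x, r x = y) -> (forall x, r x = 0 -> e x = x) ->
  forall t : tensor M N, tmap r idfun t = 0 -> tmap e idfun t = t.
Proof.
move=> rs re t rt; have [l lK] := choice rs.
pose f y := l y - e (l y).
have fE x : f (r x) = x - e x.
  have := re (l (r x) - x); rewrite raddfB /= lK subrr => /(_ erefl) /eqP.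
  rewrite raddfB /= /f subr_eq addrAC => /eqP ef.
  by rewrite ef opprB opprD addrCA addNKr.
have f_lin : linear f.
  move=> a y y'; have [[x <-] [x' <-]] := (rs y, rs y').
  by rewrite -linearP !fE linearP scalerBr opprD addrACA.
pose fl := HB.pack_for {linear M' -> M} f (GRing.isLinear.Build _ _ _ _ f f_lin).
have /(_ t) : tmap idfun idfun =1
    (fun t : tensor M N => tmap fl idfun (tmap r idfun t) + tmap e idfun t).
  apply: tens_eqfun => [|u v|x y]; first exact: raddfB.
    by rewrite !raddfB addrACA opprD.
  by rewrite !tmapE -tensDl /= fE subrK.
rewrite rt raddf0 add0r => <-.
by move: t {rt}; apply: tens_eqfun => [||x y]; rewrite ?tmapE //; exact: raddfB.
Qed.

(** * Digit expansions in inverse limits *)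

Section Limits.
Variables (Y : nat -> zmodType) (t : forall n, {additive Y n.+1 -> Y n}).
Variables (X : nat -> zmodType).
Variable S : forall n N, {additive X n -> Y N}.
Variable T : forall n, {additive Y n -> X n}.
Hypothesis tS : forall n N x, t N (S n N.+1 x) = S n N x.
Hypothesis S_gt : forall n N x, (N < n)%N -> S n N x = 0.
Hypothesis T_S : forall n x, T n (S n n x) = x.
Hypothesis T_S_lt : forall m n x, (m < n)%N -> T n (S m n x) = 0.
Hypothesis S_T0 : forall y, S 0%N 0%N (T 0%N y) = y.
Hypothesis S_T : forall n y, t n y = 0 -> S n.+1 n.+1 (T n.+1 y) = y.

Fact ilim_sum_coh (x : forall n, X n) N :
  t N (\sum_(n < N.+2) S n N.+1 (x n)) = \sum_(n < N.+1) S n N (x n).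
Proof.
rewrite raddf_sum big_ord_recr /= tS (S_gt _ (leqnn _)) addr0.
by apply: eq_bigr => i _; rewrite tS.
Qed.

(** [S n N] places a digit of degree n at level N and [T n] reads the top digit at level n. This
    scheme serves twice: for powers of the uniformizer, with digits in F_p (x) V, and for the
    adapted basis [B]. *)
Definition ilim_sum (x : forall n, X n) : ilim t :=
  ILim Y t (fun N => \sum_(n < N.+1) S n N (x n)) (ilim_sum_coh x).

Lemma ilim_sumE x N : ilim_sum x N = \sum_(n < N.+1) S n N (x n).
Proof. by []. Qed.

Lemma ilim_sum_coef x n : T n (ilim_sum x n) = x n.
Proof.
rewrite ilim_sumE raddf_sum big_ord_recr /= T_S big1 ?add0r // => i _.
by rewrite T_S_lt.
Qed.

(** By induction the difference of the two sides at level N + 1 reduces to 0 at level N, and its top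
    digit is 0; [S_T] recovers such an element from its top digit. *)
Lemma ilim_expand (h : ilim t) N : h N = \sum_(n < N.+1) S n N (T n (h n)).
Proof.
elim: N => [|N IHN]; first by rewrite big_ord1 S_T0.
set u := \sum_(n < _) _; apply/eqP; rewrite -subr_eq0.
have tu : t N (h N.+1 - u) = 0.
  by rewrite raddfB /= icoh IHN /u (ilim_sum_coh (fun n => T n (h n))) subrr.
have Tu : T N.+1 u = T N.+1 (h N.+1).
  exact: (ilim_sum_coef (fun n => T n (h n)) N.+1).
by rewrite -(S_T tu) raddfB /= Tu subrr raddf0.
Qed.

Lemma ilim_coef_inj (h : ilim t) : (forall n, T n (h n) = 0) -> h = 0.
Proof.
move=> h0; apply: ilimP => N; rewrite ilim_expand big1 // => n _.
by rewrite h0 raddf0.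
Qed.
End Limits.

(** * The ring A_p *)

Section Components.
Variables (Fq : fieldType) (A : comAlgType Fq) (p : prime_idealr A).

Lemma mem_powS0 x : (x \in powS p 0) = (x \in p).
Proof.
apply/asboolP/idP => [[s [sp ->]]|xp].
  by rewrite big_seq rpred_sum // => z /sp[zp _]; rewrite mulrC idealMr.
exists [:: (x, 1)]; rewrite big_seq1 mulr1; split=> // z.
by rewrite inE => /eqP ->.
Qed.

Lemma ideal_pow_exp n x : x \in p -> ideal_pow p n (x ^+ n).
Proof.
move=> xp; elim: n => [|n IHn] //=; exists [:: (x, x ^+ n)].
by rewrite big_seq1 -exprS; split=> // z; rewrite inE => /eqP ->.
Qed.

Lemma toAq_eq0P n a : toAq p n a = 0 <-> ideal_pow p n.+1 a.
Proof.
split=> [/eqP|an]; first by rewrite toAq_eq0 => /asboolP.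
by apply/eqP; rewrite toAq_eq0; apply/asboolP.
Qed.

Lemma ideal_powW n m a : (m <= n)%N -> ideal_pow p n a -> ideal_pow p m a.
Proof.
move=> /subnK <-; elim: (n - m)%N => [//|k IHk]; rewrite addSn => akm; apply: IHk.
case: (k + m)%N akm => [//|i] akm.
by have /powSW/asboolP : a \in powS p i.+1 by apply/asboolP.
Qed.

(** The component gets a name so that it can carry the structure of a ring morphism. *)
Definition Apc n (b : Ap p) : Aq p n := b n.
Arguments Apc : simpl never.
Fact Apc_zmod n : zmod_morphism (Apc n). Proof. by []. Qed.
HB.instance Definition _ n :=
  GRing.isZmodMorphism.Build (Ap p) (Aq p n) (Apc n) (@Apc_zmod n).
Fact Apc_mul n : monoid_morphism (Apc n). Proof. by []. Qed.
HB.instance Definition _ n :=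
  GRing.isMonoidMorphism.Build (Ap p) (Aq p n) (Apc n) (@Apc_mul n).

Lemma Apc_toAp n a : Apc n (toAp p a) = toAq p n a. Proof. by []. Qed.
Lemma Apc_red n b : redAq (Apc n.+1 b) = Apc n b. Proof. exact: icoh. Qed.
Lemma Apc_eq0W m n b : (m <= n)%N -> Apc n b = 0 -> Apc m b = 0.
Proof.
move=> /subnK <-; elim: (n - m)%N => [//|k IHk] b0; apply: IHk.
by rewrite -Apc_red; move: b0; rewrite addSn => ->; rewrite raddf0.
Qed.
Lemma Apc_inj b b' : (forall n, Apc n b = Apc n b') -> b = b'.
Proof. exact: ilimP. Qed.
Lemma Apc_surj n (z : Aq p n) : exists b, Apc n b = z.
Proof. by have [a <-] := toAq_surj z; exists (toAp p a). Qed.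
End Components.
Arguments Apc : simpl never.

(** * Divisibility by the uniformizer and power series *)

Section Complete.
Variables (Fq : fieldType) (A : comAlgType Fq) (p : prime_idealr A) (pi : A).
Local Notation Ap := (Ap p).
Local Notation Pi := (toAp p pi).
Hypothesis pi_unif : uniformizer p pi.
Variables (Kp : fieldType) (k : {rmorphism Ap -> Kp}).
Hypothesis k_frac : fraction_field k.

Lemma Pi_neq0 : Pi != 0. Proof. by apply/eqP/pi_unif.1. Qed.
(** That A_p is a domain is inherited from the field K_p, in which [k] embeds it. *)
Lemma Ap_mul_eq0 (x y : Ap) : x * y = 0 -> x = 0 \/ y = 0.
Proof.
move/(congr1 k); rewrite rmorphM rmorph0 => /eqP; rewrite mulf_eq0.
by rewrite -!(raddf0 k) => /orP[] /eqP/k_frac.1; [left|right].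
Qed.
Lemma PiI (x y : Ap) n : Pi ^+ n * x = Pi ^+ n * y -> x = y.
Proof.
elim: n => [|n IHn]; rewrite ?expr0 ?mul1r // exprS -!mulrA => /eqP.
rewrite -subr_eq0 -mulrBr => /eqP/Ap_mul_eq0[/eqP|/eqP].
  by rewrite (negPf Pi_neq0).
by rewrite subr_eq0 => /eqP/IHn.
Qed.
Lemma Apc0P (b : Ap) : Apc 0 b = 0 <-> exists c, b = Pi * c.
Proof. exact: pi_unif.2. Qed.
Lemma pi_p : pi \in p.
Proof.
rewrite -mem_powS0 -toAq_eq0 -Apc_toAp; apply/eqP/Apc0P.
by exists 1; rewrite mulr1.
Qed.
Lemma Apc_Pi_exp m n b : (n < m)%N -> Apc n (Pi ^+ m * b) = 0.
Proof.
have e : Apc n (Pi ^+ n.+1) = 0.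
  by rewrite -rmorphXn /=; apply/toAq_eq0P/ideal_pow_exp/pi_p.
by move=> /subnK <-; rewrite exprD -mulrA mulrCA rmorphM /= e mul0r.
Qed.
(** An element of p has zero component at level 0, so the uniformizer divides it in A_p; each of the
    n factors from p contributes one [Pi]. *)
Lemma toAp_pow n x : ideal_pow p n x -> exists c, toAp p x = Pi ^+ n * c.
Proof.
elim: n x => [|n IHn] x; first by exists (toAp p x); rewrite mul1r.
case=> s [sp ->]; elim: s sp => [|z s IHs] sp.
  by exists 0; rewrite big_nil raddf0 mulr0.
have [|c ec] := IHs; first by move=> y ys; apply: sp; rewrite inE ys orbT.
have [zp /IHn[d ed]] := sp z (mem_head _ _).
have /Apc0P[f ef] : Apc 0 (toAp p z.1) = 0.
  by apply/eqP; rewrite Apc_toAp toAq_eq0 mem_powS0.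
exists (f * d + c); rewrite big_cons rmorphD rmorphM /= ec ed ef exprS.
by ring.
Qed.

(* [b = Pi c] only gives the first digit of divisibility; approximating [c] by
   an element of [A] pushes the error one step further, without any limit. *)
Lemma Apc_eq0 n (b : Ap) : Apc n b = 0 <-> exists c, b = Pi ^+ n.+1 * c.
Proof.
split=> [b0|[c ->]]; last exact: Apc_Pi_exp.
have step (d : Ap) : Apc n d = 0 ->
    exists c d', d = Pi ^+ n.+1 * c + Pi * d' /\ Apc n d' = 0.
  move=> d0; have /Apc0P[e ed] := Apc_eq0W (leq0n n) d0.
  have [a ae] := toAq_surj (Apc n e).
  (* [toAp_pow] speaks of elements of A only, which is why e has been replaced by its approximation
     a. *)
  have /toAq_eq0P/toAp_pow[c] : toAq p n (pi * a) = 0.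
    by rewrite rmorphM /= ae -Apc_toAp -rmorphM /= -ed.
  rewrite rmorphM exprS -mulrA /= => /(@PiI _ _ 1) ac.
  exists c, (e - toAp p a); rewrite raddfB /= Apc_toAp ae subrr.
  by split=> //; rewrite ed ac; ring.
(* The induction counts the powers of [Pi] in front of the error term; n + 1 passes suffice. *)
have [c [d [-> _]]] :
    exists c d, b = Pi ^+ n.+1 * c + Pi ^+ n.+1 * d /\ Apc n d = 0.
  elim: {2}n.+1 => [|m [c [d [-> /step[c' [d' [-> d0]]]]]]].
    by exists 0, b; rewrite mulr0 add0r mul1r.
  exists (c + Pi ^+ m * c'), d'; split=> //; rewrite [Pi ^+ m.+1]exprS; ring.
by exists (c + d); rewrite mulrDr.
Qed.

Lemma Ap_separated (b : Ap) : (forall n, exists c, b = Pi ^+ n * c) -> b = 0.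
Proof.
move=> bn; apply: Apc_inj => n; rewrite raddf0; have [c ->] := bn n.+1.
exact: Apc_Pi_exp.
Qed.

Fact psum_coh (x : nat -> Ap) n :
  redAq (Apc n.+1 (\sum_(i < n.+2) Pi ^+ i * x i)) =
  Apc n (\sum_(i < n.+1) Pi ^+ i * x i).
Proof. by rewrite Apc_red big_ord_recr raddfD /= Apc_Pi_exp ?addr0. Qed.
(** The series of the [Pi ^+ i * x i], with arbitrary coefficients in A_p and not only digits. At
    level n the terms of index above n vanish, so a finite sum represents it. *)
Definition psum (x : nat -> Ap) : Ap :=
  ILim _ (fun n => @redAq _ _ p n)
    (fun n => Apc n (\sum_(i < n.+1) Pi ^+ i * x i)) (psum_coh x).

Lemma Apc_psum n x : Apc n (psum x) = Apc n (\sum_(i < n.+1) Pi ^+ i * x i).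
Proof. by []. Qed.

Lemma psum_recl x : psum x = x 0%N + Pi * psum (fun i => x i.+1).
Proof.
apply: Apc_inj => n; rewrite rmorphD rmorphM /=.
rewrite !Apc_psum.
rewrite -rmorphM -rmorphD mulr_sumr.
transitivity (Apc n (\sum_(i < n.+2) Pi ^+ i * x i)).
  by rewrite [in RHS]big_ord_recr raddfD /= Apc_Pi_exp ?addr0.
rewrite big_ord_recl expr0 mul1r; congr (Apc n (_ + _)).
by apply: eq_bigr => i _; rewrite mulrA -exprS.
Qed.
Lemma eq_psum x y : x =1 y -> psum x = psum y.
Proof. by move=> xy; congr psum; apply: funext. Qed.
Lemma psumB x y : psum x - psum y = psum (fun i => x i - y i).
Proof.
apply: Apc_inj => n; rewrite raddfB /= !Apc_psum -raddfB /= -sumrB.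
by congr (Apc n _); apply: eq_bigr => i _; rewrite mulrBr.
Qed.
Lemma psumM c x : c * psum x = psum (fun i => c * x i).
Proof.
apply: Apc_inj => n; rewrite rmorphM /= !Apc_psum -rmorphM /= mulr_sumr.
by congr (Apc n _); apply: eq_bigr => i _; rewrite mulrCA.
Qed.

Lemma Ap_unit1B c : exists b, (1 - Pi * c) * b = 1.
Proof.
(* The geometric series of [Pi * c]. *)
exists (psum (fun i => c ^+ i)).
rewrite mulrBl mul1r {1}psum_recl expr0 -mulrA [c * psum _]psumM.
by rewrite (eq_psum (fun i => exprS c i)) addrK.
Qed.
End Complete.

(** * Digits *)

(** This is the form in which [exprDn_pchar] yields additivity of the q-power map on a commutative
    ring under F. *)
Lemma finField_card_pchar (F : finFieldType) (R : comNzRingType)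
    (f : {rmorphism F -> R}) : [pchar R].-nat #|F|.
Proof.
have [p p_pr pF] := finPcharP F.
rewrite (card_pprimeChar pF) pnatX pnatE //; apply/orP; left.
apply/andP; split=> //.
by rewrite -(rmorph_nat f) (pcharf0 pF) rmorph0.
Qed.

Lemma exprB_card (F : finFieldType) (R : comNzRingType)
    (f : {rmorphism F -> R}) (x y : R) :
  (x - y) ^+ #|F| = x ^+ #|F| - y ^+ #|F|.
Proof.
have qn := finField_card_pchar f.
by apply/eqP; rewrite eq_sym subr_eq -exprDn_pchar // subrK.
Qed.

Section Digits.
Variables (Fq : fieldType) (A : comAlgType Fq) (p : prime_idealr A).
Variable (pi : A).
Local Notation Ap := (Ap p).
Local Notation Pi := (toAp p pi).
Hypothesis pi_unif : uniformizer p pi.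
Variables (Kp : fieldType) (k : {rmorphism Ap -> Kp}).
Hypothesis k_frac : fraction_field k.
Variables (Fp : fieldExtType Fq) (red : {lrmorphism A -> Fp}).
Hypothesis red_p : residue_field p red.
Variable s : {rmorphism Fp -> Ap}.
Hypothesis s_red : is_section red s.

Definition red0 (b : Ap) : Fp := red (repr (Apc 0 b)).
Lemma red0E b a : Apc 0 b = toAq p 0 a -> red0 b = red a.
Proof.
move=> ba; apply/eqP; rewrite -subr_eq0 -raddfB; apply/eqP/red_p.2.
by rewrite -mem_powS0 -toAq_eq0 raddfB /= -ba /toAq reprK subrr.
Qed.
Lemma red0_toAp a : red0 (toAp p a) = red a. Proof. exact: red0E. Qed.
Lemma red0_lift b : exists a, Apc 0 b = toAq p 0 a /\ red0 b = red a.
Proof.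
have [a ab] := toAq_surj (Apc 0 b); exists a; split=> //.
exact: red0E.
Qed.
Fact red0_zmod : zmod_morphism red0.
Proof.
move=> x y; have [[a [xa ->]] [b [yb ->]]] := (red0_lift x, red0_lift y).
by rewrite -raddfB; apply: red0E; rewrite !raddfB /= xa yb.
Qed.
HB.instance Definition _ := GRing.isZmodMorphism.Build Ap Fp red0 red0_zmod.
Fact red0_mul : monoid_morphism red0.
Proof.
split=> [|x y]; first by rewrite -(rmorph1 (toAp p)) red0_toAp rmorph1.
have [[a [xa ->]] [b [yb ->]]] := (red0_lift x, red0_lift y).
by rewrite -rmorphM; apply: red0E; rewrite !rmorphM /= xa yb.
Qed.
HB.instance Definition _ := GRing.isMonoidMorphism.Build Ap Fp red0 red0_mul.
Lemma red0_eq0 b : red0 b = 0 <-> Apc 0 b = 0.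
Proof.
have [a [-> ->]] := red0_lift b; split=> [/red_p.2|/eqP].
  by rewrite -mem_powS0 -toAq_eq0 => /eqP.
by rewrite toAq_eq0 mem_powS0 => /red_p.2.
Qed.
Lemma red0_s c : red0 (s c) = c.
Proof. by have [a <-] := red_p.1 c; apply: red0E; apply: s_red. Qed.
Lemma red0_Pi b : red0 (Pi * b) = 0.
Proof. by apply/red0_eq0/(Apc0P pi_unif); exists b. Qed.

Lemma sh_exists b : exists! c, b = s (red0 b) + Pi * c.
Proof.
have [|c bc] := (Apc0P pi_unif (b - s (red0 b))).1.
  by apply/red0_eq0; rewrite raddfB /= red0_s subrr.
have {}bc : b = s (red0 b) + Pi * c by rewrite -bc addrC subrK.
exists c; split=> // d; rewrite {1}bc => /addrI.
exact: (@PiI _ _ _ _ pi_unif _ _ k_frac _ _ 1).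
Qed.
(** The shift: it drops the digit of degree 0 and divides by [Pi]. All digits are obtained by
    iterating it. *)
Definition sh b : Ap := sval (cid (sh_exists b)).
Lemma shE b : b = s (red0 b) + Pi * sh b.
Proof. exact: (svalP (cid (sh_exists b))).1. Qed.
Lemma sh_uniq c d : sh (s c + Pi * d) = d.
Proof.
apply: (svalP (cid (sh_exists _))).2.
by rewrite raddfD /= red0_s red0_Pi addr0.
Qed.
Lemma sh_s c : sh (s c) = 0.
Proof. by have := sh_uniq c 0; rewrite mulr0 addr0. Qed.
Lemma sh_Pi b : sh (Pi * b) = b.
Proof. by have := sh_uniq 0 b; rewrite rmorph0 add0r. Qed.
Lemma sh_sM c b : sh (s c * b) = s c * sh b.
Proof. by rewrite {1}(shE b) mulrDr -rmorphM mulrCA sh_uniq. Qed.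
Fact sh_zmod : zmod_morphism sh.
Proof.
move=> x y; rewrite {1}(shE x) {1}(shE y) opprD addrACA -rmorphB -mulrBr.
by rewrite sh_uniq.
Qed.
HB.instance Definition _ := GRing.isZmodMorphism.Build Ap Ap sh sh_zmod.

Definition digit n b : Fp := red0 (iter n sh b).
Lemma digit0 b : digit 0 b = red0 b. Proof. by []. Qed.
Lemma digitS n b : digit n.+1 b = digit n (sh b).
Proof. by rewrite /digit iterSr. Qed.
Fact digit_zmod n : zmod_morphism (digit n).
Proof.
move=> x y; elim: n x y => [|n IHn] x y; first exact: raddfB.
by rewrite !digitS raddfB IHn.
Qed.
HB.instance Definition _ n :=
  GRing.isZmodMorphism.Build Ap Fp (digit n) (@digit_zmod n).
Lemma digit_sM n c b : digit n (s c * b) = c * digit n b.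
Proof.
elim: n b => [|n IHn] b; first by rewrite /digit /= rmorphM /= red0_s.
by rewrite !digitS sh_sM IHn.
Qed.
Lemma digit_PiS n b : digit n.+1 (Pi * b) = digit n b.
Proof. by rewrite digitS sh_Pi. Qed.
Lemma digit_Pi_lt m n b : (n < m)%N -> digit n (Pi ^+ m * b) = 0.
Proof.
elim: n m => [|n IHn] [|m] //; rewrite exprS -mulrA.
  by rewrite digit0 red0_Pi.
by rewrite digit_PiS ltnS; apply: IHn.
Qed.
Lemma digit_Pi_add m n b : digit (m + n) (Pi ^+ m * b) = digit n b.
Proof.
elim: m => [|m IHm]; first by rewrite mul1r.
by rewrite addSn exprS -mulrA digit_PiS.
Qed.
Lemma digit_s n c : digit n.+1 (s c) = 0.
Proof. by rewrite digitS sh_s raddf0. Qed.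
(** The difference is divisible by [Pi ^+ n.+1], so its n-th digit is 0. Hence [digit n] descends to
    A / p^(n+1), where it becomes [tau]. *)
Lemma digit_Apc n b b' : Apc n b = Apc n b' -> digit n b = digit n b'.
Proof.
move=> bb'; apply/eqP; rewrite -subr_eq0 -raddfB /=.
have [|c ->] := (Apc_eq0 pi_unif k_frac n (b - b')).1.
  by rewrite raddfB /= bb' subrr.
by rewrite digit_Pi_lt.
Qed.
Lemma digit_expand n b :
  b = \sum_(i < n) Pi ^+ i * s (digit i b) + Pi ^+ n * iter n sh b.
Proof.
elim: n => [|n IHn]; first by rewrite big_ord0 add0r mul1r.
rewrite big_ord_recr /= {1}IHn {1}[iter n sh b]shE -/(digit n b).
by rewrite exprSr; ring.
Qed.

Local Notation psum := (psum pi_unif).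

(** The formal derivative: for b with digits b_j, the i-th term of the series is the sum of the b_j
    Pi^(j-1) over j > i, so each j is met j times. In this form the recursion [der_rec] is
    immediate. *)
Definition der (b : Ap) : Ap := psum (fun i => iter i.+1 sh b).
Lemma der_rec b : der b = sh b + Pi * der (sh b).
Proof.
rewrite {1}/der psum_recl; congr (_ + _ * _).
by apply: eq_psum => i; rewrite [LHS]iterSr.
Qed.
Fact iter_sh_zmod n : zmod_morphism (iter n sh).
Proof. by move=> x y; elim: n => [|n IHn] //=; rewrite IHn raddfB. Qed.
Fact der_zmod : zmod_morphism der.
Proof.
move=> x y; rewrite /der psumB; apply: eq_psum => i.
exact: iter_sh_zmod.
Qed.
HB.instance Definition _ := GRing.isZmodMorphism.Build Ap Ap der der_zmod.
Lemma der_sM c b : der (s c * b) = s c * der b.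
Proof.
rewrite /der psumM; apply: eq_psum => i.
by elim: i.+1 => [|m IHm] //=; rewrite IHm sh_sM.
Qed.
Lemma der_s c : der (s c) = 0.
Proof. by rewrite der_rec sh_s raddf0 mulr0 addr0. Qed.
Lemma der_PiM b : der (Pi * b) = b + Pi * der b.
Proof. by rewrite der_rec sh_Pi. Qed.
Lemma der_Pi : der Pi = 1.
Proof. by rewrite -[Pi]mulr1 der_PiM -(rmorph1 s) der_s mulr0 addr0. Qed.

(* The defect of the Leibniz rule at (x, y) is [Pi] times the defect at
   (sh x, y), hence infinitely divisible. *)
Lemma derM x y : der (x * y) = x * der y + y * der x.
Proof.
apply/eqP; rewrite -subr_eq0; apply/eqP; apply: (Ap_separated pi_unif) => n.
elim: n x => [|n IHn] x.
  by exists (der (x * y) - (x * der y + y * der x)); rewrite mul1r.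
have [c ec] := IHn (sh x); exists c; rewrite exprS -mulrA -ec.
rewrite {1 2}(shE x) mulrDl -mulrA raddfD /= der_sM der_PiM (der_rec x).
by ring.
Qed.

Lemma unit_red0 b : red0 b != 0 -> exists b', b * b' = 1.
Proof.
(* Divided by the lift of its residue, b becomes 1 plus a multiple of [Pi]. *)
move=> b0; have [b' bb'] := Ap_unit1B pi_unif (- sh (s (red0 b)^-1 * b)).
exists (s (red0 b)^-1 * b'); rewrite mulrCA mulrA -[in RHS]bb'.
congr (_ * _); rewrite {1}[_ * b]shE rmorphM /= red0_s mulVf // rmorph1.
by rewrite mulrN opprK.
Qed.

Lemma frac_Pi y : exists a n, y = k a / k (Pi ^+ n.+1).
Proof.
have [a [b [b0 ->]]] := k_frac.2 y.
(* The valuation m of the denominator: some component of b is nonzero, and induction on its level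
   splits off factors [Pi]. *)
have [m [u [u0 bu]]] : exists m u, red0 u != 0 /\ b = Pi ^+ m * u.
  have [m0|/existsNP[m]] := pselect (forall m, Apc m b = 0).
    by case/eqP: b0; apply: Apc_inj => m; rewrite m0 raddf0.
  elim: m {a y} b b0 => [|m IHm] b b0 bm.
    by exists 0%N, b; rewrite mul1r; split=> //; apply/eqP => /red0_eq0.
  have [/eqP/red0_eq0/(Apc0P pi_unif)[c bc]|rb] := boolP (red0 b == 0); last first.
    by exists 0%N, b; rewrite mul1r.
  have [||l [u [u0 cu]]] := IHm c.
  - by apply/eqP => c0; case/eqP: b0; rewrite bc c0 mulr0.
  - move=> /(Apc_eq0 pi_unif k_frac)[d cd]; apply: bm.
    by apply/(Apc_eq0 pi_unif k_frac); exists d; rewrite bc cd mulrA -exprS.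
  by exists l.+1, u; rewrite bc cu mulrA -exprS.
(* The extra factor [Pi] in the numerator makes the exponent of the denominator positive even when m
   is 0. *)
have [v uv] := unit_red0 u0; exists (a * v * Pi), m.
have kn0 x : x != 0 -> k x != 0.
  by apply: contra_neq => kx; apply: k_frac.1; rewrite kx raddf0.
have kP := kn0 _ (Pi_neq0 pi_unif).
have ku : k u != 0.
  apply: kn0; apply: contra_neq u0 => ->; exact: raddf0.
have kv : k v = (k u)^-1.
  by apply: (mulfI ku); rewrite mulfV // -rmorphM uv rmorph1.
rewrite bu !rmorphM /= kv exprS rmorphM /= rmorphXn /=; field.
by rewrite ku kP expf_neq0.
Qed.

Variable res : Kp -> Fp.
Hypothesis res_k : residue pi s k res.

Lemma k_neq0 x : x != 0 -> k x != 0.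
Proof. by apply: contra_neq => kx; apply: k_frac.1; rewrite kx raddf0. Qed.
Lemma kPi_neq0 n : k (Pi ^+ n) != 0.
Proof. by rewrite rmorphXn expf_neq0 ?k_neq0 // (Pi_neq0 pi_unif). Qed.

Lemma res_frac a n : res (k a / k (Pi ^+ n.+1)) = digit n a.
Proof.
(* The polar part is listed by increasing pole order, so the digits of a occur in reverse and
   [digit n] belongs to the simple pole. *)
have := res_k n (fun i => digit (n - i) a) (iter n.+1 sh a).
rewrite subn0 => <-; congr res.
rewrite {1}(digit_expand n.+1 a) rmorphD mulrDl !rmorphM /=; congr (_ + _).
  rewrite rmorph_sum /= mulr_suml [RHS](reindex_inj rev_ord_inj) /=.
  apply: eq_bigr => i _; have ile : (i <= n)%N by rewrite -ltnS.
  rewrite subSS subKn // rmorphM !rmorphXn /=.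
  have -> : k Pi ^+ n.+1 = k Pi ^+ i * k Pi ^+ (n - i).+1.
    by rewrite -exprD addnS subnKC.
  by field; rewrite !expf_neq0 // k_neq0 // (Pi_neq0 pi_unif).
by rewrite mulrAC mulfV ?mul1r ?kPi_neq0.
Qed.
End Digits.

(* Both sides are fixed by the q-power map, and so is their difference, which
   is divisible by [pi], hence by all its powers. *)
Lemma section_alg (Fq : finFieldType) (A : comAlgType Fq)
    (p : prime_idealr A) (pi : A) (Fp : fieldExtType Fq)
    (red : {lrmorphism A -> Fp}) (s : {rmorphism Fp -> Ap p}) :
  uniformizer p pi -> residue_field p red -> is_section red s ->
  forall c : Fq, s c%:A = toAp p c%:A.
Proof.
move=> pi_unif red_p s_red c.
apply/eqP; rewrite -subr_eq0; apply/eqP; set z := _ - _.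
pose f : {rmorphism Fq -> Ap p} := toAp p \o in_alg A.
have zq : z ^+ #|Fq| = z.
  rewrite (exprB_card f) -rmorphXn -(rmorphXn (toAp p)) /=.
  by rewrite !exprZn !expr1n !expf_card.
have [w zw] : exists w, z = toAp p pi * w.
  apply/(Apc0P pi_unif)/(red0_eq0 red_p).
  rewrite raddfB /= (red0_s red_p s_red) (red0_toAp red_p).
  by rewrite linearZ /= rmorph1 subrr.
apply: (Ap_separated pi_unif) => n.
have zn : z = z ^+ (#|Fq| ^ n).
  by elim: n => [|n IHn]; rewrite ?expr1 // expnSr exprM -IHn zq.
(* Among the q^n factors z, n are rewritten as [Pi] times w; this uses n <= q^n. *)
exists (z ^+ (#|Fq| ^ n - n) * w ^+ n).
rewrite mulrCA -exprMn -zw -exprD subnK //.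
exact/ltnW/ltn_expl/finRing_gt1.
Qed.

(** * Digits of elements of the completed tensor product *)

Section Pairing.
Variables (Fq : fieldType) (A : comAlgType Fq) (p : prime_idealr A).
Variable (pi : A).
Local Notation Ap := (Ap p).
Local Notation Pi := (toAp p pi).
Hypothesis pi_unif : uniformizer p pi.
Variables (Kp : fieldType) (k : {rmorphism Ap -> Kp}).
Hypothesis k_frac : fraction_field k.
Variables (Fp : fieldExtType Fq) (red : {lrmorphism A -> Fp}).
Hypothesis red_p : residue_field p red.
Variable s : {rmorphism Fp -> Ap}.
Hypothesis s_red : is_section red s.
Hypothesis s_alg : forall c : Fq, s c%:A = toAp p c%:A.
Local Notation sh := (sh pi_unif k_frac red_p s_red).
Local Notation digit := (digit pi_unif k_frac red_p s_red).
Local Notation der := (der pi_unif k_frac red_p s_red).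

Lemma Ap_complete : complete_module pi (Ap^o : lmodType Ap).
Proof.
split=> [x x0|u uC].
  apply: (Ap_separated pi_unif) => n; have [z] := x0 n.
  by rewrite subr0 => ->; exists z.
have [z uz] := choice uC.
(* A telescoping series: z n is the quotient of u (n+1) - u n by [Pi ^+ n]. *)
exists (u 0%N + psum pi_unif z) => n.
suff -> : u 0%N + psum pi_unif z =
    u n + Pi ^+ n * psum pi_unif (fun i => z (n + i)%N).
  by exists (- psum pi_unif (fun i => z (n + i)%N));
     rewrite opprD addNKr scalerN.
elim: n => [|n ->]; first by rewrite mul1r.
rewrite psum_recl addn0 mulrDr addrA -[u n.+1](subrK (u n)) uz.
rewrite [_ + u n]addrC exprSr -mulrA; congr (_ + _ * (_ * _)).
by apply: eq_psum => i; rewrite addSnnS.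
Qed.

(** Only the universal property of Omega is at hand. Existence, applied to [der], provides the
    coordinate g; uniqueness, applied to d itself, shows that [d Pi] generates. *)
Lemma differentials_basis (Omega : lmodType Ap) (d : Ap -> Omega) :
  cont_differentials pi s d ->
  exists g : {linear Omega -> Ap^o},
    g (d Pi) = 1 /\ forall w, w = (g w : Ap) *: d Pi.
Proof.
case=> [[dD dM ds] dC univ].
have der_der : derivation s (der : Ap -> Ap^o).
  split=> [x y|x y|c]; first exact: (raddfD der).
    exact: derM.
  exact: der_s.
have [g [gd _]] := univ _ _ Ap_complete der_der; exists g.
split=> [|w]; first by rewrite -gd; apply: der_Pi.
(* The defect of this identity at b is [Pi] times the defect at [sh b], hence infinitely divisible,
   and Omega is separated. *)
have d_der b : d b = (der b : Ap) *: d Pi.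
  apply/eqP; rewrite -subr_eq0; apply/eqP; apply: dC.1 => n.
  elim: n b => [|n IHn] b.
    by exists (d b - der b *: d Pi); rewrite subr0 scale1r.
  have [z] := IHn (sh b); rewrite subr0 => zE; exists z.
  rewrite subr0 exprS -scalerA -zE {1 2}(shE pi_unif k_frac red_p s_red b).
  rewrite dD ds add0r dM raddfD /= der_s add0r der_PiM scalerDl -scalerA.
  by rewrite opprD addrA addrK scalerBr.
(* Both f and the identity carry d to d, so they are equal. *)
pose f w := (g w : Ap) *: d Pi.
have f_lin : linear f by move=> a x y; rewrite /f linearP scalerDl scalerA.
pose fl := HB.pack_for {linear Omega -> Omega} f
  (GRing.isLinear.Build _ _ _ _ f f_lin).
have [h [_ h_uniq]] := univ _ _ dC (And3 dD dM ds).
rewrite -[RHS]/(fl w) (h_uniq fl) => [|b]; last by rewrite /= /f -gd.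
by rewrite -(h_uniq idfun).
Qed.

Definition tau n (z : Aq p n) : Fp := digit n (toAp p (repr z)).
Lemma tau_Apc n b : tau (Apc n b) = digit n b.
Proof.
by apply: digit_Apc; rewrite Apc_toAp /toAq reprK.
Qed.
(** F_q acts on A / p^(n+1) through A, while digits are linear over s(F_p). [s_alg] reconciles the
    two, so that digits can be tensored with V over F_q. *)
Lemma Aq_scale_Apc n c (b : Ap) : c *: Apc n b = Apc n (s c%:A * b).
Proof. by rewrite s_alg rmorphM. Qed.
Fact tau_linear n : linear (@tau n).
Proof.
move=> c z z'; have [[b <-] [b' <-]] := (Apc_surj z, Apc_surj z').
rewrite Aq_scale_Apc -raddfD !tau_Apc raddfD /= digit_sM.
by rewrite mulr_algl.
Qed.
HB.instance Definition _ n :=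
  GRing.isLinear.Build Fq (Aq p n) Fp _ (@tau n) (@tau_linear n).

Definition sigma n N (c : Fp) : Aq p N := Apc N (Pi ^+ n * s c).
Fact sigma_linear n N : linear (sigma n N).
Proof.
move=> a c c'; rewrite /sigma Aq_scale_Apc -raddfD; congr Apc.
by rewrite -[a *: c]mulr_algl rmorphD rmorphM /=; ring.
Qed.
HB.instance Definition _ n N :=
  GRing.isLinear.Build Fq Fp (Aq p N) _ (sigma n N) (sigma_linear n N).

Variable V : fq_module A.
Local Notation FpV := (tensor Fp V).
Local Notation PT := (ptensor p V).

Definition coef (h : PT) n : FpV := tmap (@tau n) idfun (h n).
Fact coef_zmod n : zmod_morphism (coef^~ n).
Proof. by move=> h h'; rewrite /coef -raddfB. Qed.
Lemma coef_add (h h' : PT) n : coef (h + h') n = coef h n + coef h' n.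
Proof. by rewrite /coef -raddfD. Qed.

Lemma pt_scale_Apc (b : Ap) (h : PT) n :
  (b *: h) n = tmap (mulAq (Apc n b)) idfun (h n).
Proof. by []. Qed.
Lemma pt_red (h : PT) n : tmap (@redAq _ _ p n) idfun (h n.+1) = h n.
Proof. exact (icoh h n). Qed.

Lemma coef_Pi h n : coef (Pi *: h) n.+1 = coef h n.
Proof.
rewrite /coef pt_scale_Apc -[in RHS](pt_red h n); move: (h n.+1).
apply: tens_eqfun => [x y|x y|z v]; rewrite /= ?raddfB /= ?raddfB // !tmapE /=.
have [b <-] := Apc_surj z.
by rewrite Apc_red /mulAq -rmorphM !tau_Apc digit_PiS.
Qed.
Lemma coef_Pi_add m h n : coef (Pi ^+ m *: h) (m + n) = coef h n.
Proof.
elim: m => [|m IHm]; first by rewrite scale1r.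
by rewrite addSn exprS -scalerA coef_Pi.
Qed.
Lemma coef_Pi_lt m h n : (n < m)%N -> coef (Pi ^+ m *: h) n = 0.
Proof.
move=> nm; rewrite /coef pt_scale_Apc; move: (h n).
apply: tens_eqfun => [x y|x y|z v];
  rewrite /= ?raddfB /= ?raddfB ?subrr // !tmapE /=.
have [b <-] := Apc_surj z.
by rewrite /mulAq -rmorphM /= (Apc_Pi_exp pi_unif) // raddf0 tens0l.
Qed.
Lemma coef_s c h n : coef (s c *: h) n = Fp_mul c (coef h n).
Proof.
rewrite /coef pt_scale_Apc; move: (h n).
apply: tens_eqfun => [x y|x y|z v];
  rewrite /Fp_mul /= ?raddfB /= ?raddfB // !tmapE /=.
have [b <-] := Apc_surj z.
by rewrite /mulAq -rmorphM !tau_Apc digit_sM lfunE.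
Qed.
Lemma coef_act a h n : coef (pt_act a h) n = FpV_act a (coef h n).
Proof.
rewrite /coef /FpV_act -[pt_act a h n]/(tmap idfun (fqm_act V a) (h n)).
move: (h n).
by apply: tens_eqfun => [x y|x y|z v]; rewrite /= ?raddfB /= ?raddfB // !tmapE.
Qed.
Let S n N : {additive FpV -> tensor (Aq p N) V} := tmap (sigma n N) idfun.
Let T n : {additive tensor (Aq p n) V -> FpV} := tmap (@tau n) idfun.

Fact coef_tS n N x : tmap (@redAq _ _ p N) idfun (S n N.+1 x) = S n N x.
Proof.
move: x; apply: tens_eqfun => [x y|x y|z v];
  rewrite /S /= ?raddfB /= ?raddfB // !tmapE /=.
by rewrite /sigma Apc_red.
Qed.
Fact coef_S_gt n N x : (N < n)%N -> S n N x = 0.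
Proof.
move=> Nn; move: x.
apply: tens_eqfun => [x y|x y|z v];
  rewrite /S /= ?raddfB /= ?raddfB ?subrr // tmapE /=.
by rewrite /sigma (Apc_Pi_exp pi_unif) // tens0l.
Qed.
Fact coef_T_S n x : T n (S n n x) = x.
Proof.
move: x; apply: tens_eqfun => [x y|x y|z v];
  rewrite /S /T /= ?raddfB /= ?raddfB // !tmapE /=.
rewrite /sigma tau_Apc -[X in digit X]addn0 digit_Pi_add.
by rewrite digit0 red0_s.
Qed.
Fact coef_T_S_lt m n x : (m < n)%N -> T n (S m n x) = 0.
Proof.
move=> mn; move: x.
apply: tens_eqfun => [x y|x y|z v];
  rewrite /S /T /= ?raddfB /= ?raddfB ?subrr // !tmapE /=.
rewrite /sigma tau_Apc -(subnKC mn) addSnnS digit_Pi_add.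
by rewrite digit_s tens0l.
Qed.
Let e n : {linear Aq p n -> Aq p n} := (sigma n n \o @tau n).
Let ST n : S n n \o T n =1 tmap (e n) idfun.
Proof.
by apply: tens_eqfun => [x y|x y|z v];
  rewrite /S /T /= ?raddfB /= ?raddfB // !tmapE.
Qed.
Fact coef_S_T0 y : S 0 0 (T 0 y) = y.
Proof.
rewrite [LHS]ST; move: y.
apply: tens_eqfun => [x y|x y|z v]; rewrite /= ?raddfB /= ?raddfB // !tmapE /=.
have [b <-] := Apc_surj z; rewrite /sigma tau_Apc mul1r digit0.
congr tens; rewrite [in RHS](shE pi_unif k_frac red_p s_red b) raddfD /=.
rewrite [X in _ + X](Apc_eq0 pi_unif k_frac 0 _).2 ?addr0 //.
by exists (sh b).
Qed.
(** The kernel of A / p^(n+2) -> A / p^(n+1) consists of multiples of [Pi ^+ n.+1], which are their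
    own top terms, so [e] fixes them; [tmap_ker] carries this to the tensor product. *)
Fact coef_S_T n y : tmap (@redAq _ _ p n) idfun y = 0 ->
  S n.+1 n.+1 (T n.+1 y) = y.
Proof.
move=> y0; rewrite [LHS]ST; apply: tmap_ker y0 => [z|z].
  by have [b <-] := Apc_surj z; exists (Apc n.+1 b); exact: Apc_red.
have [b <-] := Apc_surj z; rewrite /= Apc_red.
move=> /(Apc_eq0 pi_unif k_frac)[c ->]; rewrite /= /sigma tau_Apc.
have := digit_Pi_add pi_unif k_frac red_p s_red n.+1 0 c.
rewrite addn0 => ->; rewrite digit0.
rewrite [in RHS](shE pi_unif k_frac red_p s_red c) mulrDr raddfD /=.
rewrite [X in _ + X](Apc_eq0 pi_unif k_frac _ _).2 ?addr0 //.
by exists (sh c); rewrite mulrA -exprSr.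
Qed.

Lemma coef_inj (h : PT) : (forall n, coef h n = 0) -> h = 0.
Proof.
exact: (ilim_coef_inj coef_tS coef_S_gt coef_T_S coef_T_S_lt coef_S_T0 coef_S_T).
Qed.
Lemma coef_surj (x : nat -> FpV) : exists h : PT, forall n, coef h n = x n.
Proof.
exists (ilim_sum coef_tS coef_S_gt x) => n.
exact: (ilim_sum_coef coef_tS coef_S_gt coef_T_S coef_T_S_lt).
Qed.
End Pairing.

(** * The residue pairing *)

Section PairingHom.
Variables (Fq : fieldType) (A : comAlgType Fq) (p : prime_idealr A).
Variable (pi : A).
Local Notation Ap := (Ap p).
Local Notation Pi := (toAp p pi).
Hypothesis pi_unif : uniformizer p pi.
Variables (Kp : fieldType) (k : {rmorphism Ap -> Kp}).
Hypothesis k_frac : fraction_field k.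
Variables (Fp : fieldExtType Fq) (red : {lrmorphism A -> Fp}).
Hypothesis red_p : residue_field p red.
Variable s : {rmorphism Fp -> Ap}.
Hypothesis s_red : is_section red s.
Hypothesis s_alg : forall c : Fq, s c%:A = toAp p c%:A.
Variable V : fq_module A.
Local Notation FpV := (tensor Fp V).
Local Notation PT := (ptensor p V).
Local Notation sh := (sh pi_unif k_frac red_p s_red).
Local Notation digit := (digit pi_unif k_frac red_p s_red).
Local Notation coef := (coef pi_unif k_frac red_p s_red s_alg).
Local Notation KA := (fquot k).
Definition pfrac (a : Ap) n : KA := fclass k (k a / k (Pi ^+ n)).

Implicit Types a b : Ap.
Lemma pfrac_add a b n : pfrac a n + pfrac b n = pfrac (a + b) n.
Proof. by rewrite /pfrac -raddfD /= -mulrDl -rmorphD. Qed.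
Lemma pfrac_sub a b n : pfrac a n - pfrac b n = pfrac (a - b) n.
Proof. by rewrite /pfrac -raddfB /= -mulrBl -rmorphB. Qed.
Lemma pfrac_scale b a n : b *: pfrac a n = pfrac (b * a) n.
Proof. by rewrite /pfrac [LHS]fscaleE mulrA -rmorphM. Qed.
Lemma pfrac_Pi a m n : pfrac (Pi ^+ m * a) (m + n) = pfrac a n.
Proof.
congr fclass; have kP j := kPi_neq0 pi_unif k_frac j.
by rewrite exprD !rmorphM /=; field; rewrite !kP.
Qed.
Lemma pfrac_PiS a n : pfrac (Pi * a) n.+1 = pfrac a n.
Proof. exact: (pfrac_Pi a 1 n). Qed.
Lemma pfrac0 a : pfrac a 0 = 0.
Proof.
apply/eqP; rewrite /pfrac fclass_eq0; apply/asboolP; exists a.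
by rewrite rmorph1 divr1.
Qed.
Lemma pfrac_surj (x : KA) : exists (a : Ap) n, x = pfrac a n.+1.
Proof.
have [y <-] := fclass_surj x.
have [a [n ->]] := frac_Pi pi_unif k_frac red_p s_red y.
by exists a, n.
Qed.
Lemma pfrac_surj2 (x y : KA) :
  exists (a b : Ap) n, x = pfrac a n.+1 /\ y = pfrac b n.+1.
Proof.
have [[a [n ->]] [b [m ->]]] := (pfrac_surj x, pfrac_surj y).
exists (Pi ^+ m.+1 * a), (Pi ^+ n.+1 * b), (m + n.+1)%N.
by rewrite -addSn pfrac_Pi addnC pfrac_Pi.
Qed.

Lemma coef_sub (h h' : PT) n : coef (h - h') n = coef h n - coef h' n.
Proof. exact: coef_zmod. Qed.
(** After clearing denominators, both sides are digits of degree n + m + 1, and an element of A_p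
    added to the fraction contributes only a multiple of Pi^(n+m+2). *)
Lemma coef_pfrac (h : PT) a n a' m : pfrac a n.+1 = pfrac a' m.+1 ->
  coef (a *: h) n = coef (a' *: h) m.
Proof.
move=> /eqP; rewrite /pfrac -subr_eq0 -raddfB fclass_eq0 => /asboolP[b kb].
have {kb} : Pi ^+ m.+1 * a = Pi ^+ n.+1 * a' + Pi ^+ (m.+1 + n.+1) * b.
  apply: k_frac.1; have kP j := kPi_neq0 pi_unif k_frac j.
  rewrite rmorphD !rmorphM /= kb exprD rmorphM /=; field.
  by rewrite !kP.
move=> ab; rewrite -(coef_Pi_add pi_unif k_frac red_p s_red s_alg m.+1).
rewrite -[RHS](coef_Pi_add pi_unif k_frac red_p s_red s_alg n.+1) !scalerA ab.
rewrite [(n.+1 + m)%N]addSnnS [(n + m.+1)%N]addnC scalerDl coef_add.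
rewrite -[(_ * b) *: h]scalerA.
by rewrite [X in _ + X]coef_Pi_lt ?addr0 // ltn_add2l.
Qed.

(** The classes of a / Pi^(n+1) exhaust K_p / A_p; [coef_pfrac] gives consistency and a common
    denominator gives additivity. No basis is chosen here: the residue formula over [B] is
    [pairing_formal]. *)
Lemma pairing_exists : exists J : PT -> homz KA FpV,
  forall h a n, J h (pfrac a n.+1) = coef (a *: h) n.
Proof.
suff /choice[J JE] : forall h : PT, exists j : homz KA FpV,
    forall a n, j (pfrac a n.+1) = coef (a *: h) n by exists J.
move=> h.
have [f fE] : exists f : KA -> FpV, forall a n, f (pfrac a n.+1) = coef (a *: h) n.
  have /choice[f fP] : forall x : KA, exists v, forall a n,
      x = pfrac a n.+1 -> v = coef (a *: h) n.
    move=> x; have [a [n ->]] := pfrac_surj x; exists (coef (a *: h) n).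
    by move=> b m /coef_pfrac.
  by exists f => a n; apply: fP.
have fB : zmod_morphism f.
  move=> x y; have [a [b [n [-> ->]]]] := pfrac_surj2 x y.
  by rewrite pfrac_sub !fE scalerBl coef_sub.
by exists (HomZ fB).
Qed.
Definition pairing : PT -> homz KA FpV := sval (cid pairing_exists).
Lemma pairingE h a n : pairing h (pfrac a n.+1) = coef (a *: h) n.
Proof. exact: svalP (cid pairing_exists) h a n. Qed.

Fact pairing_linear : linear pairing.
Proof.
move=> b h h'; apply: homzP => x; have [a [n ->]] := pfrac_surj x.
rewrite pairingE.
rewrite -[RHS]/(pairing h (b *: pfrac a n.+1) + pairing h' (pfrac a n.+1)).
by rewrite pfrac_scale !pairingE scalerDr scalerA (mulrC a b) coef_add.
Qed.
HB.instance Definition _ :=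
  GRing.isLinear.Build Ap PT (homz KA FpV) _ pairing pairing_linear.

Lemma pairing_Fp h : Hom_Fp s (pairing h).
Proof.
move=> c x; have [a [n ->]] := pfrac_surj x.
by rewrite pfrac_scale !pairingE -scalerA coef_s.
Qed.
Lemma pairing_act (a : A) h :
  pairing (pt_act a h) = homz_post (@FpV_act _ _ Fp V a) (pairing h).
Proof.
apply: homzP => x; have [b [n ->]] := pfrac_surj x.
by rewrite /= !pairingE -linearZ coef_act.
Qed.
(** The value at the class of 1 / Pi^(n+1) is the n-th digit of h, and the digits determine h. *)
Lemma pairing_inj : injective pairing.
Proof.
move=> h h' hh; apply/eqP; rewrite -subr_eq0; apply/eqP.
have cn n : coef (h - h') n = 0.
  by rewrite -[_ - _]scale1r -pairingE raddfB /= hh subrr.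
exact (coef_inj cn).
Qed.
(** The classes of Pi^(-n-1) span K_p / A_p over F_p: splitting off the digit of degree 0 of the
    numerator leaves a fraction with a pole of lower order. *)
Lemma Hom_Fp_eq (f g : homz KA FpV) : Hom_Fp s f -> Hom_Fp s g ->
  (forall n, f (pfrac 1 n.+1) = g (pfrac 1 n.+1)) -> f = g.
Proof.
move=> fs gs fg; apply: homzP => x; have [a [n ->]] := pfrac_surj x.
elim: n.+1 a {x} => [|m IHm] a; first by rewrite pfrac0 !raddf0.
rewrite (shE pi_unif k_frac red_p s_red a) -pfrac_add pfrac_PiS.
rewrite -[X in pfrac X _ + _]mulr1 -pfrac_scale.
by rewrite !raddfD /= fs gs fg IHm.
Qed.
Lemma pairing_surj (f : homz KA FpV) : Hom_Fp s f -> exists h, pairing h = f.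
Proof.
move=> fs; have [h hE] := coef_surj pi_unif k_frac red_p s_red s_alg
  (fun n => f (pfrac 1 n.+1)).
exists h; apply: Hom_Fp_eq (pairing_Fp h) fs _ => n.
by rewrite pairingE scale1r.
Qed.
End PairingHom.

(** * The trace form *)

Section TraceForm.
Variables (Fq : finFieldType) (Fp : fieldExtType Fq).
Local Notation q := #|Fq|.
Local Notation m := (\dim {:Fp}).
Local Notation e := (vbasis {:Fp}).
Local Notation tr := (@trFp Fq Fp).
Local Arguments trFp : simpl never.

Fact trFp_scalar : scalar tr.
Proof. by move=> c x y; rewrite trFp_linear. Qed.
HB.instance Definition _ := GRing.isLinear.Build Fq Fp Fq^o _ tr trFp_scalar.

Lemma trFpZ c x : tr (c *: x) = c * tr x.
Proof. by have := trFp_linear x 0 c; rewrite addr0 raddf0 addr0. Qed.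

Lemma frobD j (x y : Fp) : (x + y) ^+ (q ^ j) = x ^+ (q ^ j) + y ^+ (q ^ j).
Proof. by rewrite exprDn_pchar // pnatX (finField_card_pchar (in_alg Fp)). Qed.
Lemma frobZ j c (x : Fp) : (c *: x) ^+ (q ^ j) = c *: x ^+ (q ^ j).
Proof.
rewrite exprZn; congr (_ *: _).
by elim: j => [|j IHj]; rewrite ?expr1 // expnSr exprM IHj expf_card.
Qed.
Lemma frob_sum j I (r : seq I) (x : I -> Fp) :
  (\sum_(i <- r) x i) ^+ (q ^ j) = \sum_(i <- r) x i ^+ (q ^ j).
Proof.
apply: (big_morph (fun x => x ^+ (q ^ j)) (frobD j)).
by rewrite expr0n expn_eq0 -leqn0 leqNgt (ltnW (finRing_gt1 _)).
Qed.

Lemma dim_gt0 : (0 < m)%N.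
Proof.
rewrite lt0n dimv_eq0 -subv0; apply/negP => /subvP/(_ 1 (memvf 1)).
by rewrite memv0 oner_eq0.
Qed.

(* Such a q-polynomial has degree at most q^(m-1) but q^m roots. *)
Lemma frob_free (v : 'I_m -> Fp) :
  (forall x, \sum_(j < m) v j * x ^+ (q ^ j) = 0) -> forall j, v j = 0.
Proof.
move=> v0; pose P := \sum_(j < m) v j *: 'X^(q ^ j).
have q1 := finRing_gt1 Fq.
have [P0|Pn0] := eqVneq P 0.
  move=> j; have := congr1 (fun Q : {poly Fp} => Q`_(q ^ j)) P0.
  rewrite coef0 coef_sum (bigD1 j) //= coefZ coefXn eqxx mulr1 big1 ?addr0 //.
  move=> i ij; rewrite coefZ coefXn eqn_exp2l //.
  by rewrite eq_sym -val_eqE in ij; rewrite (negPf ij) mulr0.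
pose rs : seq Fp := enum (finvect_type Fp).
have := max_poly_roots Pn0 (rs := rs).
have -> : all (root P) rs.
  apply/allP => x _; rewrite rootE horner_sum; apply/eqP.
  by rewrite -[RHS](v0 x); apply: eq_bigr => j _; rewrite hornerZ hornerXn.
rewrite (enum_uniq (finvect_type Fp)) => /(_ isT isT).
have -> : size rs = (q ^ m)%N.
  transitivity #|finvect_type Fp|; first by rewrite cardE.
  exact: etrans (esym (@card_vspacef Fq (finvect_type Fp) _))
    (@card_vspace Fq (finvect_type Fp) _ fullv).
rewrite ltnNge => /negP[]; apply: (leq_trans (size_sum _ _ _)).
apply/bigmax_leqP => j _; apply: (leq_trans (size_scale_leq _ _)).
by rewrite size_polyXn ltn_exp2l.
Qed.

(** The Moore matrix [Q] of the conjugates of a basis is invertible and conjugates the transposed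
    matrix of multiplication by x to the diagonal matrix of the conjugates of x. *)
Lemma trFp_frob x : (tr x)%:A = \sum_(j < m) x ^+ (q ^ j).
Proof.
pose Q : 'M[Fp]_m := \matrix_(j, i) e`_i ^+ (q ^ j).
pose M := passmx.mxof e e (amull x).
pose M' := map_mx (in_alg Fp) M.
have e_basis := vbasisP {:Fp}.
(* A relation between the rows is a q-polynomial that vanishes on the basis, hence on all of F_p, so
   [frob_free] applies. *)
have Qfree : row_free Q.
  apply: inj_row_free => v vQ; apply/rowP => j; rewrite [RHS]mxE.
  apply: (frob_free (v := fun j => v 0 j)) => y.
  rewrite (coord_basis e_basis (memvf y)).
  under eq_bigr do rewrite frob_sum mulr_sumr.
  rewrite exchange_big big1 // => i _.
  have := congr1 (fun w : 'rV_m => coord e i y *: w 0 i) vQ.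
  rewrite !mxE scaler0 scaler_sumr => vQi; rewrite -[RHS]vQi.
  by apply: eq_bigr => l _; rewrite !mxE frobZ scalerAr.
have Qu : Q \in unitmx by rewrite -row_free_unit.
pose D : 'M[Fp]_m := diag_mx (\row_j x ^+ (q ^ j)).
(* Both entries at (j, i) are the q^j-th power of x e_i, since the entries of M come from F_q. The
   transpose reflects the row convention of [mxof]. *)
have DQ : D *m Q = Q *m M'^T.
  apply/matrixP => j i; rewrite mul_diag_mx !mxE -exprMn.
  have -> : x * e`_i = \sum_k M i k *: e`_k.
    have -> : x * e`_i = amull x e`_i by rewrite lfunE.
    rewrite -[e`_i](passmx.vecof_delta e).
    rewrite (passmx.hom_vecof e e_basis) -rowE /passmx.vecof.
    by apply: eq_bigr => k _; rewrite mxE.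
  rewrite frob_sum; apply: eq_bigr => k _; rewrite !mxE frobZ.
  by rewrite mulr_algr.
rewrite -[LHS]/(in_alg Fp (\tr M)) -trace_map_mx -/M' -mxtrace_tr.
rewrite -[M'^T]mul1mx -(mulVmx Qu) -mulmxA -DQ mxtrace_mulC -mulmxA mulmxV //.
by rewrite mulmx1 mxtrace_diag; apply: eq_bigr => j _; rewrite mxE.
Qed.

(** A zero trace would make the q-polynomial with all coefficients 1 vanish identically. *)
Lemma trFp_neq0 : exists c, tr c != 0.
Proof.
apply: contrapT => /forallNP tr0; have : (1 : Fp) = 0.
  apply: (frob_free (v := fun=> 1)) (Ordinal dim_gt0) => x.
  under eq_bigr do rewrite mul1r.
  by rewrite -trFp_frob; have := tr0 x; case: eqP => // -> _; rewrite scale0r.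
by move/eqP; rewrite oner_eq0.
Qed.

Lemma trFp_nondeg x : (forall y, tr (x * y) = 0) -> x = 0.
Proof.
have [c /eqP c0] := trFp_neq0.
move=> x0; apply/eqP; apply: contra_notT c0 => xn0.
by rewrite -(x0 (x^-1 * c)) mulVKf.
Qed.

(** Nondegeneracy makes the Gram matrix of the trace form invertible, and its inverse yields the
    dual basis. The first expansion serves [tr_id_surj], the second [tr_id_inj]. *)
Lemma trFp_dual : exists e' : 'I_m -> Fp,
  (forall x, x = \sum_(i < m) tr (x * e' i) *: e`_i) /\
  (forall x, x = \sum_(i < m) tr (e`_i * x) *: e' i).
Proof.
have e_basis := vbasisP {:Fp}; have e_free := basis_free e_basis.
have tr_e0 y : (forall i : 'I_m, tr (e`_i * y) = 0) -> y = 0.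
  move=> y0; apply: trFp_nondeg => z; rewrite mulrC.
  rewrite (coord_basis e_basis (memvf z)) mulr_suml raddf_sum /= big1 // => i _.
  by rewrite -scalerAl trFpZ y0 mulr0.
pose G : 'M[Fq]_m := \matrix_(i, j) tr (e`_i * e`_j).
have Gu : G \in unitmx.
  rewrite -row_free_unit; apply: inj_row_free => v vG.
  have y0 : \sum_i v 0 i *: e`_i = 0.
    apply: tr_e0 => j; have := congr1 (fun w : 'rV_m => w 0 j) vG.
    rewrite !mxE => vGj; rewrite -[RHS]vGj mulr_sumr raddf_sum /=.
    by apply: eq_bigr => i _; rewrite mxE -scalerAr trFpZ [e`_j * _]mulrC.
  by apply/rowP => i; rewrite [RHS]mxE; have /freeP := e_free; apply.
pose e' (j : 'I_m) := \sum_k invmx G j k *: e`_k.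
have ee' (i j : 'I_m) : tr (e`_i * e' j) = (i == j)%:R.
  have := congr1 (fun M : 'M_m => M j i) (mulVmx Gu).
  rewrite !mxE eq_sym => <-; rewrite mulr_sumr raddf_sum /=.
  by apply: eq_bigr => k _; rewrite !mxE -scalerAr trFpZ [e`_i * _]mulrC.
have ee'_sum (f : 'I_m -> Fq) (j : 'I_m) :
    \sum_i f i * tr (e`_i * e' j) = f j.
  rewrite (bigD1 j) //= ee' eqxx mulr1 big1 ?addr0 // => i ij.
  by rewrite ee' (negPf ij) mulr0.
exists e'; split=> x.
  rewrite {1}(coord_basis e_basis (memvf x)); apply: eq_bigr => j _.
  congr (_ *: _); rewrite {2}(coord_basis e_basis (memvf x)) mulr_suml.
  rewrite raddf_sum /= -[LHS](ee'_sum (fun i => coord e i x)).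
  by apply: eq_bigr => i _; rewrite -scalerAl trFpZ.
apply/eqP; rewrite -subr_eq0; apply/eqP/tr_e0 => i.
have -> : e`_i * (x - \sum_(j < m) tr (e`_j * x) *: e' j) =
    e`_i * x - \sum_(j < m) tr (e`_j * x) *: (e`_i * e' j).
  by rewrite mulrBr mulr_sumr; under eq_bigr do rewrite -scalerAr.
rewrite [LHS](raddfB tr) /= [X in _ - X](raddf_sum tr) /= (bigD1 i) //=.
rewrite trFpZ ee' eqxx big1 ?addr0 => [|j ij].
  by rewrite mulr1 subrr.
by rewrite trFpZ ee' eq_sym (negPf ij) mulr0.
Qed.

End TraceForm.

(** * Composition with the trace *)

Section TraceHom.
Variables (Fq : finFieldType) (Fp : fieldExtType Fq).
Variables (A : comAlgType Fq) (V : fq_module A).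
Local Notation FpV := (tensor Fp V).
Local Notation Fp_mul := (@Fp_mul Fq A Fp V).
Local Notation tr_id := (@tr_id Fq Fp V).

Lemma tr_idE c v : tr_id (tens c v) = trFp c *: v.
Proof. exact: tens_liftE. Qed.
Lemma Fp_mulE c d v : Fp_mul c (tens d v) = tens (c * d) v.
Proof. by rewrite /Defs.Fp_mul tmapE /= lfunE. Qed.
Lemma Fp_mulB c x y : Fp_mul c (x - y) = Fp_mul c x - Fp_mul c y.
Proof. by rewrite /Defs.Fp_mul raddfB. Qed.
Lemma Fp_mulM c d t : Fp_mul c (Fp_mul d t) = Fp_mul (c * d) t.
Proof.
move: t; apply: tens_eqfun => [x y|x y|z v]; rewrite ?Fp_mulB ?Fp_mulE ?mulrA //.
Qed.
Lemma Fp_mul1 t : Fp_mul 1 t = t.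
Proof.
move: t; apply: tens_eqfun => [x y|x y|z v]; rewrite ?Fp_mulB ?Fp_mulE ?mul1r //.
Qed.
Lemma tr_id_act a t : tr_id (FpV_act a t) = fqm_act V a (tr_id t).
Proof.
move: t; apply: tens_eqfun => [x y|x y|z v]; rewrite ?raddfB //.
by rewrite /FpV_act tmapE !tr_idE linearZ.
Qed.
Lemma Fp_mul_act a c t : Fp_mul c (FpV_act a t) = FpV_act a (Fp_mul c t).
Proof.
move: t; apply: tens_eqfun => [x y|x y|z v]; rewrite ?(raddfB, Fp_mulB) //.
by rewrite /FpV_act tmapE !Fp_mulE tmapE.
Qed.
Lemma tr_id_mul_alg c t : tr_id (Fp_mul c%:A t) = c *: tr_id t.
Proof.
move: t; apply: tens_eqfun => [x y|x y|z v];
  rewrite ?(raddfB, Fp_mulB) ?scalerBr //.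
by rewrite Fp_mulE !tr_idE mulr_algl trFpZ scalerA.
Qed.

Lemma tr_id_inj t u :
  (forall c, tr_id (Fp_mul c t) = tr_id (Fp_mul c u)) -> t = u.
Proof.
have [e' [_ ee']] := trFp_dual Fp.
suff tE : forall t, t = \sum_(i < \dim {:Fp})
    tens (e' i) (tr_id (Fp_mul (vbasis {:Fp})`_i t)).
  move=> tu; rewrite (tE t) (tE u); apply: eq_bigr => i _.
  by rewrite tu.
apply: tens_eqfun => [//|x y|z v].
  rewrite -sumrB; apply: eq_bigr => i _.
  by rewrite Fp_mulB raddfB /= -scaleN1r tensDr tensZr scaleN1r.
rewrite {1}(ee' z) tens_suml; apply: eq_bigr => i _.
by rewrite Fp_mulE tr_idE tensZl tensZr.
Qed.
(** Together with [tr_id_inj] this identifies F_p (x) V with Hom_Fq(F_p, V) by means of the trace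
    form. *)
Lemma tr_id_surj (g : {linear Fp -> V}) :
  exists t, forall c, tr_id (Fp_mul c t) = g c.
Proof.
have [e' [ee' _]] := trFp_dual Fp.
exists (\sum_(i < \dim {:Fp}) tens (e' i) (g (vbasis {:Fp})`_i)) => c.
rewrite {2}(ee' c) [RHS]raddf_sum /Defs.Fp_mul [X in tr_id X]raddf_sum.
rewrite [LHS]raddf_sum /=.
apply: eq_bigr => i _.
by rewrite -[tmap _ _ _]/(Fp_mul c _) Fp_mulE tr_idE linearZ.
Qed.

Variables (p : prime_idealr A) (s : {rmorphism Fp -> Ap p}).
Hypothesis s_alg : forall c : Fq, s c%:A = toAp p c%:A.
Variable Q : lmodType (Ap p).
Local Notation post := (@homz_post _ Q _ _ tr_id).
Implicit Type f : homz Q FpV.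

Lemma post_tr_linear : linear post.
Proof. by move=> b f g; apply: homzP => x /=; rewrite raddfD. Qed.
Lemma post_tr_act a f : post (homz_post (@FpV_act _ _ Fp V a) f) =
  homz_post (fqm_act V a) (post f).
Proof. by apply: homzP => x /=; rewrite tr_id_act. Qed.
Lemma post_tr_Fq f : Hom_Fp s f -> Hom_Fq (post f).
Proof. by move=> fs c x; rewrite /= -s_alg fs tr_id_mul_alg. Qed.
Lemma post_tr_inj f g : Hom_Fp s f -> Hom_Fp s g -> post f = post g -> f = g.
Proof.
move=> fs gs fg; apply: homzP => x; apply: tr_id_inj => c.
by rewrite -fs -gs -[LHS]/(post f (s c *: x)) fg.
Qed.
Lemma post_tr_surj (g : homz Q V) : Hom_Fq g ->
  exists2 f, Hom_Fp s f & post f = g.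
Proof.
move=> gq.
(* f x is the tensor that represents the F_q-linear map sending c to [g (s c *: x)]; since it is
   unique, f is additive and F_p-linear. *)
have /choice[f fE] : forall x, exists t, forall c,
    tr_id (Fp_mul c t) = g (s c *: x).
  move=> x; pose h c := g (s c *: x).
  have h_lin : linear h.
    move=> a c d; rewrite /h -[a *: c]mulr_algl rmorphD rmorphM /= s_alg.
    by rewrite scalerDl raddfD /= -scalerA gq.
  exact: (tr_id_surj (HB.pack_for {linear Fp -> V} h
    (GRing.isLinear.Build _ _ _ _ h h_lin))).
have fB : zmod_morphism f.
  move=> x y; apply: tr_id_inj => c.
  by rewrite Fp_mulB raddfB /= !fE scalerBr raddfB.
exists (HomZ fB) => [c x|]; last first.
  by apply: homzP => x /=; rewrite -[f x]Fp_mul1 fE rmorph1 scale1r.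
apply: tr_id_inj => d /=.
by rewrite Fp_mulM !fE scalerA rmorphM.
Qed.
(** A tensor is determined by the traces of its F_p-multiples, and A commutes with F_p, so
    A-linearity can be tested after the trace. *)
Lemma post_tr_A f : Hom_Fp s f -> Hom_A (post f) -> Hom_FpA s f.
Proof.
move=> fs fA; split=> // a x; apply: tr_id_inj => c.
rewrite Fp_mul_act tr_id_act -!fs scalerA mulrC -scalerA.
exact: fA.
Qed.
Lemma post_tr_FpA f : Hom_FpA s f -> Hom_A (post f).
Proof. by case=> _ fA a x; rewrite /= fA tr_id_act. Qed.
End TraceHom.

(** * Formal sums over an adapted basis *)

Section Formal.
Variables (Fq : fieldType) (A : comAlgType Fq) (p : prime_idealr A).
Variables (V : fq_module A) (B : nat -> seq A).
Hypothesis B_pow : forall n (i : 'I_(size (B n))), ideal_pow p n (B n)`_i.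
Hypothesis B_basis : forall n x, ideal_pow p n x ->
  exists! c : {ffun 'I_(size (B n)) -> Fq},
    ideal_pow p n.+1 (x - \sum_i c i *: (B n)`_i).

Local Notation b n m i := (toAq p n (B m)`_i).
Local Notation expansion n c :=
  (\sum_(m < n.+1) \sum_(i < size (B m)) c m i *: b n m i).

Lemma toAqZ n c x : toAq p n (c *: x) = c *: toAq p n x.
Proof. by rewrite Aq_scaleE -rmorphM /= mulr_algl. Qed.
Lemma b_gt n m (i : 'I_(size (B m))) : (n < m)%N -> b n m i = 0.
Proof. by move=> nm; apply/toAq_eq0P; apply: ideal_powW nm (B_pow i). Qed.

Lemma expansion_red n (c : nat -> nat -> Fq) :
  redAq (expansion n.+1 c) = expansion n c.
Proof.
rewrite big_ord_recr raddfD /= [X in _ + X]raddf_sum /=.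
rewrite [X in _ + X]big1 ?addr0 => [|i _]; last first.
  by rewrite -toAqZ /= redAqE toAqZ b_gt ?scaler0.
rewrite raddf_sum; apply: eq_bigr => m _; rewrite raddf_sum /=.
by apply: eq_bigr => i _; rewrite -toAqZ /= redAqE toAqZ.
Qed.

Lemma top_exists n x : ideal_pow p n x ->
  exists c : nat -> Fq, toAq p n x = \sum_(i < size (B n)) c i *: b n n i.
Proof.
move=> /B_basis[c [/toAq_eq0P xc _]].
(* Coefficients are extended by 0 to all of [nat], which keeps index types depending on n out of the
   inductions. *)
exists (fun i => if insub i is Some j then c j else 0).
move/eqP: xc; rewrite raddfB /= subr_eq0 => /eqP ->; rewrite raddf_sum /=.
by apply: eq_bigr => i _; rewrite valK toAqZ.
Qed.
Lemma top_free n (c : nat -> Fq) :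
  \sum_(i < size (B n)) c i *: b n n i = 0 ->
  forall i, (i < size (B n))%N -> c i = 0.
Proof.
move=> c0 i ilt; have [|d [_ d_uniq]] := B_basis (n := n) (x := 0).
  by case: (n) => [//|n0]; exists [::]; rewrite big_nil.
have c1 : [ffun i : 'I_(size (B n)) => - c i] = d.
  apply/esym/d_uniq/toAq_eq0P; rewrite sub0r -sumrN raddf_sum /= -[RHS]c0.
  by apply: eq_bigr => j _; rewrite ffunE scaleNr opprK /= toAqZ.
have d0 : [ffun=> 0] = d.
  apply/esym/d_uniq/toAq_eq0P; rewrite sub0r raddfN raddf_sum /= big1 ?oppr0 //.
  by move=> j _; rewrite ffunE scale0r raddf0.
have := congr1 (fun f : {ffun _} => f (Ordinal ilt)) (etrans c1 (esym d0)).
by rewrite !ffunE /= => /eqP; rewrite oppr_eq0 => /eqP.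
Qed.

(** An expansion modulo p^(n+1), read modulo p^(n+2), has an error in p^(n+1), which is absorbed by
    the coefficients of [B n.+1]. *)
Lemma expansion_exists n (z : Aq p n) : exists c : nat -> nat -> Fq,
  z = expansion n c.
Proof.
elim: n z => [|n IHn] z.
  have [x <-] := toAq_surj z; have [c ->] := @top_exists 0 x I.
  by exists (fun=> c); rewrite big_ord1.
have [c zc] := IHn (redAq z).
have [x xE] := toAq_surj (z - expansion n.+1 c).
have /toAq_eq0P/top_exists[c' c'E] : toAq p n x = 0.
  by rewrite -redAqE xE raddfB /= expansion_red zc subrr.
exists (fun m i => if (m == n.+1)%N then c m i + c' i else c m i).
rewrite -[LHS](subrK (expansion n.+1 c)) -xE c'E [in RHS]big_ord_recr /= eqxx.
rewrite [LHS]addrC [X in X + _ = _]big_ord_recr /= -addrA -big_split /=.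
congr (_ + _).
  apply: eq_bigr => m _; apply: eq_bigr => i _.
  by rewrite ltn_eqF // ltnS ltnW.
by apply: eq_bigr => i _; rewrite scalerDl.
Qed.
Lemma expansion_free n (c : nat -> nat -> Fq) : expansion n c = 0 ->
  forall m i, (m <= n)%N -> (i < size (B m))%N -> c m i = 0.
Proof.
elim: n => [|n IHn] c0 m i.
  by rewrite leqn0 => /eqP->; apply: top_free; rewrite -[RHS]c0 big_ord1.
have {}IHn : forall m i, (m <= n)%N -> (i < size (B m))%N -> c m i = 0.
  by apply: IHn; rewrite -expansion_red c0 raddf0.
rewrite leq_eqVlt => /orP[/eqP->|]; last exact: IHn.
apply: top_free; move: c0; rewrite big_ord_recr /= big1 ?add0r // => j _.
by rewrite big1 // => l _; rewrite IHn ?scale0r // -ltnS.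
Qed.

(** A choice of coefficients; the entries with m <= n and i < size (B m) are the ones determined by
    z. *)
Definition coord_B n (z : Aq p n) : nat -> nat -> Fq :=
  sval (cid (expansion_exists z)).
Lemma coord_BE n (z : Aq p n) : z = expansion n (coord_B z).
Proof. exact: svalP (cid (expansion_exists z)). Qed.
Lemma coord_B_uniq n (c : nat -> nat -> Fq) m i :
  (m <= n)%N -> (i < size (B m))%N -> coord_B (expansion n c) m i = c m i.
Proof.
move=> mn ilt; apply/eqP; rewrite -subr_eq0; apply/eqP.
set z := expansion n c.
apply: (@expansion_free n (fun m i => coord_B z m i - c m i)) => //.
have := coord_BE z; rewrite {1}/z => /eqP; rewrite eq_sym -subr_eq0.
rewrite -sumrB => /eqP e; rewrite -[RHS]e; apply: eq_bigr => j _.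
by rewrite -sumrB; apply: eq_bigr => l _; rewrite scalerBl.
Qed.
Lemma coord_B_linear n (i : 'I_(size (B n))) a (z z' : Aq p n) :
  coord_B (a *: z + z') n i = a * coord_B z n i + coord_B z' n i.
Proof.
pose c m i : Fq := a * coord_B z m i + coord_B z' m i.
rewrite -[RHS](@coord_B_uniq n c) //; congr (coord_B _ _ _).
rewrite {1}(coord_BE z) {1}(coord_BE z') scaler_sumr -big_split.
apply: eq_bigr => m _; rewrite scaler_sumr -big_split; apply: eq_bigr => j _.
by rewrite /= scalerDl scalerA.
Qed.
Lemma coord_B_b n m (i : 'I_(size (B n))) (j : 'I_(size (B m))) :
  (m <= n)%N -> coord_B (b n m j) n i = ((m == n) && (i == j :> nat))%:R.
Proof.
move=> mn; pose c (m' i' : nat) : Fq := ((m == m') && (i' == j :> nat))%:R.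
rewrite -[RHS]/(c n i) -[RHS](@coord_B_uniq n c) //; congr (coord_B _ _ _).
rewrite (bigD1 (Ordinal (mn : (m < n.+1)%N))) //= (bigD1 j) //= /c !eqxx scale1r.
rewrite !big1 ?addr0 // => [l|l lj].
  rewrite eq_sym -val_eqE /= => /negPf lm; rewrite big1 // => i' _.
  by rewrite lm scale0r.
by rewrite (negPf (lj : _ != _ :> nat)) andbF scale0r.
Qed.

Let X n : zmodType := {ffun 'I_(size (B n)) -> V}.
Definition Bsum n N (u : X n) : tensor (Aq p N) V :=
  \sum_(i < size (B n)) tens (b N n i) (u i).
Fact Bsum_zmod n N : zmod_morphism (@Bsum n N).
Proof.
move=> u v; rewrite /Bsum -sumrB; apply: eq_bigr => i _.
by rewrite !ffunE -scaleN1r tensDr tensZr scaleN1r.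
Qed.
HB.instance Definition _ n N :=
  GRing.isZmodMorphism.Build (X n) (tensor (Aq p N) V) (@Bsum n N)
    (@Bsum_zmod n N).

Fact coord_B_bilin n (i : 'I_(size (B n))) :
  bilin (fun (z : Aq p n) (v : V) => coord_B z n i *: v).
Proof.
split=> [v|z] a x y; first by rewrite coord_B_linear scalerDl scalerA.
by rewrite scalerDr !scalerA mulrC.
Qed.
Definition Bcoef n (t : tensor (Aq p n) V) : X n :=
  [ffun i => tens_lift (coord_B_bilin i) t].
Fact Bcoef_zmod n : zmod_morphism (@Bcoef n).
Proof. by move=> t u; apply/ffunP => i; rewrite !ffunE raddfB. Qed.
HB.instance Definition _ n :=
  GRing.isZmodMorphism.Build (tensor (Aq p n) V) (X n) (@Bcoef n)
    (@Bcoef_zmod n).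

Fact B_tS n N (u : X n) : tmap (@redAq _ _ p N) idfun (Bsum N.+1 u) = Bsum N u.
Proof.
by rewrite /Bsum raddf_sum; apply: eq_bigr => i _; rewrite [LHS]tmapE /= redAqE.
Qed.
Fact B_S_gt n N (u : X n) : (N < n)%N -> Bsum N u = 0.
Proof. by move=> Nn; rewrite /Bsum big1 // => i _; rewrite b_gt // tens0l. Qed.
Fact Bcoef_Bsum m n (u : X m) i : (m <= n)%N ->
  Bcoef (Bsum n u) i =
  \sum_(j < size (B m)) ((m == n) && (i == j :> nat))%:R *: u j.
Proof.
move=> mn; rewrite ffunE /Bsum raddf_sum; apply: eq_bigr => j _.
by rewrite [LHS]tens_liftE coord_B_b.
Qed.
Fact B_T_S n (u : X n) : Bcoef (Bsum n u) = u.
Proof.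
apply/ffunP => i; rewrite Bcoef_Bsum // (bigD1 i) //= !eqxx scale1r.
rewrite big1 ?addr0 // => j ji.
by rewrite eq_sym (negPf (ji : _ != _ :> nat)) scale0r.
Qed.
Fact B_T_S_lt m n (u : X m) : (m < n)%N -> Bcoef (Bsum n u) = 0.
Proof.
move=> mn; apply/ffunP => i; rewrite Bcoef_Bsum ?(ltnW mn) // ffunE big1 // => j _.
by rewrite ltn_eqF // scale0r.
Qed.

(** The counterpart of [e] for the basis [B]: it fixes the kernel of the reduction from level n to
    level n - 1. *)
Definition Btop n (z : Aq p n) : Aq p n :=
  \sum_(i < size (B n)) coord_B z n i *: b n n i.
Fact Btop_linear n : linear (@Btop n).
Proof.
move=> a z z'; rewrite /Btop scaler_sumr -big_split; apply: eq_bigr => i _.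
by rewrite coord_B_linear scalerDl scalerA.
Qed.
HB.instance Definition _ n :=
  GRing.isLinear.Build Fq (Aq p n) (Aq p n) _ (@Btop n) (@Btop_linear n).
Lemma Bsum_Bcoef n t : Bsum n (Bcoef t) = tmap (@Btop n) idfun t.
Proof.
move: t; apply: tens_eqfun => [x y|x y|z v]; rewrite ?raddfB //.
rewrite tmapE /Btop tens_suml; apply: eq_bigr => i _.
by rewrite ffunE tens_liftE tensZr tensZl.
Qed.
Fact B_S_T0 t : Bsum 0 (@Bcoef 0 t) = t.
Proof.
rewrite Bsum_Bcoef; move: t; apply: tens_eqfun => [x y|x y|z v].
- by rewrite raddfB.
- by [].
- by rewrite tmapE /= [in RHS](coord_BE z) big_ord1.
Qed.
Fact B_S_T n (t : tensor (Aq p n.+1) V) :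
  tmap (@redAq _ _ p n) idfun t = 0 -> Bsum n.+1 (Bcoef t) = t.
Proof.
rewrite Bsum_Bcoef; apply: tmap_ker => [z|z z0].
  by have [a <-] := toAq_surj z; exists (toAq p n.+1 a); rewrite /= redAqE.
rewrite [RHS](coord_BE z) big_ord_recr /= big1 ?add0r // => m _.
rewrite big1 // => i _; rewrite (@expansion_free n (coord_B z)) ?scale0r //.
  by rewrite -expansion_red -coord_BE.
by rewrite -ltnS.
Qed.

Lemma formal_sum_exists_unique (h : ptensor p V) :
  exists! u : forall n, 'I_(size (B n)) -> V, is_formal_sum u h.
Proof.
exists (fun n i => Bcoef (h n) i); split=> [N|u hu].
  exact: (ilim_expand B_tS B_S_gt B_T_S B_T_S_lt B_S_T0 B_S_T h N).
pose x n : X n := [ffun i => u n i].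
have hx : h = ilim_sum B_tS B_S_gt x.
  apply: ilimP => N; rewrite hu; apply: eq_bigr => n _.
  by apply: eq_bigr => i _; rewrite ffunE.
apply: functional_extensionality_dep => n; apply: funext => i.
by rewrite hx (ilim_sum_coef B_tS B_S_gt B_T_S B_T_S_lt) ffunE.
Qed.
End Formal.

(** * Scalars act linearly on an Anderson module *)

Lemma card_pred_gt0 (F : finFieldType) : (0 < #|F|.-1)%N.
Proof. by have := finRing_gt1 F; case: #|F| => [|[|n]]. Qed.

Section PolyAction.
Variables (Fq : finFieldType) (W : lmodType Fq) (f : {linear W -> W}) (c : Fq).

Implicit Type P : {poly Fq}.

Definition poly_act (P : {poly Fq}) x := \sum_(i < size P) P`_i *: iter i f x.
Lemma poly_act_widen n P x : (size P <= n)%N ->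
  poly_act P x = \sum_(i < n) P`_i *: iter i f x.
Proof.
move=> Pn; rewrite /poly_act (big_ord_widen _ (fun i => P`_i *: iter i f x) Pn).
rewrite big_mkcond /=; apply: eq_bigr => i _.
by case: ltnP => // /leq_sizeP-> //; rewrite scale0r.
Qed.
Lemma poly_act_XsubC P x :
  poly_act (('X - c%:P) * P) x = f (poly_act P x) - c *: poly_act P x.
Proof.
rewrite (@poly_act_widen (size P).+1 (_ * P)); last first.
  by apply: leq_trans (size_polyMleq _ _) _; rewrite size_XsubC.
rewrite [X in _ - c *: X](@poly_act_widen (size P).+1) //.
have -> : f (poly_act P x) = \sum_(i < (size P).+1) ('X * P)`_i *: iter i f x.
  rewrite big_ord_recl coefXM eqxx scale0r add0r raddf_sum /=.
  by apply: eq_bigr => i _; rewrite linearZ coefXM.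
rewrite scaler_sumr -sumrB; apply: eq_bigr => i _.
by rewrite mulrBl coefB coefCM scalerBl scalerA.
Qed.
Lemma iter_sub_scale n x :
  iter n (fun y => f y - c *: y) x = poly_act (('X - c%:P) ^+ n) x.
Proof.
elim: n => [|n IHn].
  by rewrite (@poly_act_widen 1) ?size_poly1 // big_ord1 coef1 scale1r.
by rewrite iterS IHn exprS poly_act_XsubC.
Qed.
(** The identity (X - c)^q = X^q - c in F_q[X], evaluated at f. *)
Lemma iter_card_sub_scale x :
  iter #|Fq| (fun y => f y - c *: y) x = iter #|Fq| f x - c *: x.
Proof.
rewrite iter_sub_scale (exprB_card (@polyC Fq)) -polyC_exp expf_card.
set q := #|Fq|; rewrite (@poly_act_widen q.+1); last first.
  apply: leq_trans (size_polyD _ _) _; rewrite size_polyXn size_polyN geq_max leqnn.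
  exact: leq_trans (size_polyC_leq1 _) _.
under eq_bigr do rewrite coefB scalerBl.
rewrite sumrB; congr (_ - _).
  rewrite big_ord_recr /= coefXn eqxx scale1r big1 ?add0r // => i _.
  by rewrite coefXn ltn_eqF // scale0r.
rewrite big_ord_recl coefC eqxx big1 ?addr0 // => i _.
by rewrite coefC scale0r.
Qed.
End PolyAction.

Section EvalPoly.
Variables (L : comNzRingType) (R : comAlgType L) (a : R).
(** Named in order to be packed as an [lrmorphism], the kind of map that acts on points. *)
Definition eval_poly (P : {poly L}) : R := horner_alg a P.
Lemma eval_polyX : eval_poly 'X = a. Proof. exact: horner_algX. Qed.
Fact eval_poly_linear : linear eval_poly.
Proof.
move=> b P Q; rewrite /eval_poly rmorphD -mul_polyC rmorphM /=.
by rewrite horner_algC mulr_algl.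
Qed.
HB.instance Definition _ := GRing.isLinear.Build L {poly L} R _ eval_poly
  eval_poly_linear.
Fact eval_poly_mul : monoid_morphism eval_poly.
Proof. by split=> [|P Q]; rewrite /eval_poly ?rmorph1 ?rmorphM. Qed.
HB.instance Definition _ := GRing.isMonoidMorphism.Build {poly L} R eval_poly
  eval_poly_mul.
End EvalPoly.

Section AndersonScalars.
Variables (Fq : finFieldType) (L : fieldType) (iL : {rmorphism Fq -> L}).
Variables (A : comAlgType Fq) (l : {rmorphism A -> L}) (d : nat).
Hypothesis l_alg : forall c : Fq, l c%:A = iL c.
Variable E : anderson_module iL l d.
Local Notation pt := (pts (am_sch E)).
Variable theta : forall R : comAlgType L, pt R -> 'rV[R]_d.
Hypothesis theta_bij : forall R, bijective (@theta R).
Hypothesis thetaD : forall (R : comAlgType L) (x y : pt R),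
  theta (x + y) = theta x + theta y.
Hypothesis thetaZ : forall (R : comAlgType L) (a : Fq) (x : pt R),
  theta (a *: x) = ((iL a)%:A : R) *: theta x.
Hypothesis theta_nat : forall (R S : comAlgType L) (u : {lrmorphism R -> S})
  (x : pt R), theta (Defs.pmap (am_sch E) u x) = map_mx u (theta x).
Variable c : Fq.

(** This is psi, kept as a natural family over all R because its vanishing is proved over L[X] and
    then specialised. *)
Definition defect (R : comAlgType L) (x : pt R) : pt R :=
  am_phi E c%:A R x - c *: x.
Lemma defectB (R : comAlgType L) : zmod_morphism (@defect R).
Proof.
move=> x y; rewrite /defect scalerBr raddfB /=.
by rewrite [- (c *: x - _)]opprD opprK addrACA opprB [- _ + c *: y]addrC.
Qed.
Lemma defect_nat (R S : comAlgType L) (u : {lrmorphism R -> S}) x :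
  defect (Defs.pmap (am_sch E) u x) = Defs.pmap (am_sch E) u (defect x).
Proof. by rewrite /defect eapp_nat raddfB [X in _ = _ - X]linearZ. Qed.

Lemma iter_phi n (R : comAlgType L) x :
  iter n (am_phi E c%:A R) x = am_phi E (c%:A ^+ n) R x.
Proof.
by elim: n => [|n IHn]; rewrite ?am_phi1 //= IHn exprS am_phiM.
Qed.
(** psi^q = psi because (phi_c - c)^q = phi_(c^q) - c and c^q = c. Hence psi equals arbitrarily high
    iterates of itself, those of order n (q - 1) + 1. *)
Lemma iter_defect n (R : comAlgType L) (x : pt R) :
  iter (n * #|Fq|.-1).+1 (@defect R) x = defect x.
Proof.
elim: n => [//|n IHn]; rewrite mulSn -addnS iterD IHn -iterSr prednK.
  rewrite [LHS](iter_card_sub_scale (am_phi E c%:A R)) iter_phi exprZn expr1n.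
  by rewrite expf_card.
exact/ltnW/finRing_gt1.
Qed.

Lemma theta_inj (R : comAlgType L) : injective (@theta R).
Proof. exact: bij_inj. Qed.
Lemma theta0 (R : comAlgType L) : theta (0 : pt R) = 0.
Proof. by apply: (addIr (theta (0 : pt R))); rewrite -thetaD !add0r. Qed.
Lemma defect0 (R : comAlgType L) : defect (0 : pt R) = 0.
Proof. by rewrite /defect raddf0 scaler0 subr0. Qed.

Lemma theta_LieE (x : pt (dual L)) : Lie x <-> forall i, (theta x 0 i).1 = 0.
Proof.
have e : theta (Defs.pmap (am_sch E) (@dual_eval L) x) = \row_i (theta x 0 i).1.
  by rewrite theta_nat; apply/rowP => i; rewrite !mxE.
split=> [x0 i|x0].
  have := congr1 (fun v : 'rV_d => v 0 i) e.
  by rewrite /Lie in x0; rewrite x0 theta0 !mxE => <-.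
by apply: theta_inj; rewrite e theta0; apply/rowP => i; rewrite !mxE x0.
Qed.
Lemma Lie_scale_alg (x : pt (dual L)) : Lie x -> Lie_scale (l c%:A) x = c *: x.
Proof.
move=> /theta_LieE x0; apply: theta_inj; rewrite theta_nat thetaZ l_alg.
apply/rowP => i; rewrite !mxE; have := x0 i; case: (theta x 0 i) => u v /= ->.
by congr pair; rewrite /= /GRing.scale /= !mulr0 ?mulr1 ?addr0.
Qed.
Lemma Lie_defect (x : pt (dual L)) : Lie x -> Lie (defect x).
Proof. by rewrite /Lie -defect_nat => ->; rewrite defect0. Qed.
(** On Lie E the scalars c and l(c) agree, so psi is nilpotent there; being equal to high iterates
    of itself, it vanishes. *)
Lemma defect_Lie (x : pt (dual L)) : Lie x -> defect x = 0.
Proof.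
move=> xL; have [n nil] := am_nil E c%:A.
have iterE m : Lie (iter m (@defect (dual L)) x) /\
    iter m (fun y => am_phi E c%:A (dual L) y - Lie_scale (l c%:A) y) x =
    iter m (@defect (dual L)) x.
  elim: m => [//|m [IHL IHm]]; split; first exact: Lie_defect.
  by rewrite /= IHm /defect Lie_scale_alg.
have n_le : (n <= (n * #|Fq|.-1).+1)%N.
  by rewrite leqW ?leq_pmulr ?card_pred_gt0.
rewrite -(iter_defect n) -(subnK n_le) iterD -(iterE n).2 nil //.
by elim: (_ - _)%N => //= m ->; rewrite defect0.
Qed.

Definition axis (R : comAlgType L) (i : 'I_d) (a : R) : 'rV[R]_d :=
  \row_j (if j == i then a else 0).

Lemma horner_dual_eq0 (P : {poly L}) :
  eval_poly ((0, 1) : dual L) P = 0 -> exists Q, P = 'X^2 * Q.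
Proof.
set eps : dual L := (0, 1).
have eps2 : eps ^+ 2 = 0.
  by congr pair; rewrite /= ?mulr0 // mul0r addr0.
rewrite -{1}(poly_take_drop 2 P) rmorphD rmorphM rmorphXn /= !eval_polyX eps2.
rewrite mulr0 addr0.
have -> : take_poly 2 P = (P`_0)%:P + P`_1 *: 'X.
  apply/polyP => i; rewrite coef_take_poly coefD coefC coefZ coefX.
  by case: i => [|[|i]] //=; rewrite ?mulr0 ?mulr1 ?addr0 ?add0r.
rewrite rmorphD /= linearZ /= eval_polyX [eval_poly _ _]horner_algC => P0.
have [p0 p1] : P`_0 = 0 /\ P`_1 = 0.
  have e : (P`_0)%:A + P`_1 *: eps = (P`_0, P`_1) :> dual L.
    by congr pair; rewrite /= /GRing.scale /= ?mulr0 ?mulr1 ?addr0 ?add0r.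
  by move: P0; rewrite e => -[-> ->].
by exists (drop_poly 2 P); rewrite -{1}(poly_take_drop 2 P) mulrC
  (_ : take_poly 2 P = 0) ?add0r //; apply/polyP => i;
  rewrite coef_take_poly coef0; case: i => [|[|i]].
Qed.

(** Specialising X to eps turns x into a point of Lie E, which psi kills; evaluation at eps sees
    exactly the coefficients of degree 0 and 1. *)
Lemma axis_defect_sq i (x : pt {poly L}) : theta x = axis i 'X ->
  forall j, exists Q : {poly L}, theta (defect x) 0 j = 'X^2 * Q.
Proof.
move=> xi j; apply: horner_dual_eq0.
pose ev : {lrmorphism {poly L} -> dual L} :=
  eval_poly ((0, 1) : dual L).
have : Lie (Defs.pmap (am_sch E) ev x).
  apply/theta_LieE => m; rewrite theta_nat xi !mxE.
  by case: eqP; rewrite ?rmorph0 //= eval_polyX.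
move=> /defect_Lie; rewrite defect_nat => /(congr1 (fun y => theta y 0 j)).
by rewrite theta_nat theta0 !mxE.
Qed.
(** The point with coordinate X over L[X] is universal on the i-th axis, so naturality along X |-> a
    computes psi at every other point of that axis. *)
Lemma axis_defect (R : comAlgType L) i (a : R) (x : pt {poly L}) y :
  theta x = axis i 'X -> theta y = axis i a ->
  theta (defect y) = map_mx (eval_poly a) (theta (defect x)).
Proof.
move=> xi ya; rewrite -theta_nat -defect_nat; congr (theta (defect _)).
apply: theta_inj; rewrite ya theta_nat xi; apply/rowP => j; rewrite !mxE.
by case: eqP; rewrite ?rmorph0 //= eval_polyX.
Qed.
Lemma theta_surj (R : comAlgType L) v : exists x : pt R, theta x = v.
Proof. by have [g _ gK] := theta_bij R; exists (g v). Qed.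

Lemma theta_defect_sum (R : comAlgType L) (x : pt R) (y : 'I_d -> pt R) :
  (forall i, theta (y i) = axis i (theta x 0 i)) ->
  theta (defect x) = \sum_i theta (defect (y i)).
Proof.
move=> yE; have -> : x = \sum_i y i.
  apply: theta_inj; rewrite (big_morph _ (@thetaD R) (@theta0 R)).
  apply/rowP => j; rewrite summxE (bigD1 j) //= yE mxE eqxx big1 ?addr0 // => i ij.
  by rewrite yE mxE eq_sym (negPf ij).
rewrite -(big_morph _ (@thetaD R) (@theta0 R)); congr theta.
pose f := HB.pack_for {additive pt R -> pt R} (@defect R)
  (GRing.isZmodMorphism.Build _ _ _ (@defectB R)).
exact: (raddf_sum f).
Qed.

(** By additivity x may be taken on an axis. A polynomial divisible by X^2, evaluated at a multiple
    of X^(n+1), is divisible by X^(2n+2), hence by X^(n+2). *)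
Lemma defect_Xdiv n (x : pt {poly L}) :
  (forall i, exists r : {poly L}, theta x 0 i = 'X^(n.+1) * r) ->
  forall j, exists r : {poly L}, theta (defect x) 0 j = 'X^(n.+2) * r.
Proof.
move=> xn j; have [xs xsE] := choice (fun i => theta_surj (axis i ('X : {poly L}))).
have [y yE] := choice (fun i => theta_surj (axis i (theta x 0 i))).
rewrite (theta_defect_sum yE) summxE.
suff /choice[r rE] : forall i, exists r : {poly L},
    theta (defect (y i)) 0 j = 'X^(n.+2) * r.
  by exists (\sum_i r i); rewrite mulr_sumr; apply: eq_bigr.
move=> i; rewrite (axis_defect (xsE i) (yE i)) mxE.
have [Q ->] := axis_defect_sq (xsE i) j; have [r ->] := xn i.
exists ('X^n * r ^+ 2 * eval_poly ('X^(n.+1) * r) Q).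
have e : 'X^(n.+1) ^+ 2 = 'X^(n.+2) * 'X^n :> {poly L}.
  by rewrite -exprM -exprD muln2 -addnn [in RHS]addSnnS.
rewrite rmorphM rmorphXn /= eval_polyX exprMn e.
by rewrite !mulrA.
Qed.

Lemma axis_defect_eq0 i (x : pt {poly L}) : theta x = axis i 'X -> defect x = 0.
Proof.
move=> xi; apply: theta_inj; rewrite theta0; apply/rowP => j; rewrite [RHS]mxE.
apply/polyP => m; rewrite coef0.
have iterX n k : exists r : {poly L},
    theta (iter n (@defect {poly L}) x) 0 k = 'X^(n.+1) * r.
  elim: n k => [|n IHn] k; last exact: defect_Xdiv.
  rewrite /= xi mxE; case: eqP => _; first by exists 1; rewrite mulr1.
  by exists 0; rewrite mulr0.
(* This iterate is psi itself and is divisible by X^(m(q-1)+2), so its coefficient of degree m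
   vanishes. *)
have [r] := iterX (m * #|Fq|.-1).+1 j; rewrite iter_defect => ->.
by rewrite coefXnM ltnS leqW ?leqW ?leq_pmulr ?card_pred_gt0.
Qed.

Lemma defect_eq0 (R : comAlgType L) (x : pt R) : defect x = 0.
Proof.
apply: theta_inj; rewrite theta0.
have [y yE] := choice (fun i => theta_surj (axis i (theta x 0 i))).
rewrite (theta_defect_sum yE) big1 // => i _.
have [x0 x0E] := theta_surj (axis i ('X : {poly L})).
rewrite (axis_defect x0E (yE i)) (axis_defect_eq0 x0E) theta0.
by apply/rowP => j; rewrite !mxE rmorph0.
Qed.
End AndersonScalars.

Lemma anderson_scalar (Fq : finFieldType) (L : fieldType)
    (iL : {rmorphism Fq -> L}) (A : comAlgType Fq) (l : {rmorphism A -> L})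
    (d : nat) (E : anderson_module iL l d) (R : comAlgType L) (c : Fq) x :
  (forall c : Fq, l c%:A = iL c) -> am_phi E c%:A R x = c *: x.
Proof.
move=> l_alg; have [theta [tb tD tZ tn]] := am_iso E.
apply/eqP; rewrite -subr_eq0; apply/eqP.
exact: (defect_eq0 l_alg tb tD tZ tn).
Qed.

(** * The isomorphisms *)

Section FreeRankOne.
Variables (R : comNzRingType) (M N N' : lmodType R) (w : M).
Variable g : {linear M -> R^o}.
Hypothesis g_w : forall x, x = (g x : R) *: w.

Fact contract_bilin (P : lmodType R) :
  bilin (fun (x : M) (y : P) => (g x : R) *: y).
Proof.
split=> [y|x] a u v; first by rewrite linearP scalerDl scalerA.
by rewrite scalerDr !scalerA mulrC.
Qed.
(** When g w = 1, this inverts the map y |-> w (x) y from P to M (x) P. *)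
Definition contract (P : lmodType R) : tensor M P -> P :=
  tens_lift (contract_bilin P).
HB.instance Definition _ (P : lmodType R) :=
  GRing.Linear.copy (@contract P) (tens_lift (contract_bilin P)).
Lemma contractE (P : lmodType R) x (y : P) :
  contract (tens x y) = (g x : R) *: y.
Proof. exact: tens_liftE. Qed.
Lemma contractK (t : tensor M N) : t = tens w (contract t).
Proof.
move: t; apply: tens_eqfun => [//|x y|x y].
  by rewrite raddfB /= -scaleN1r tensDr tensZr scaleN1r.
by rewrite contractE tensZr -tensZl -g_w.
Qed.
Lemma contract_tmap (u : {linear N -> N'}) t :
  contract (tmap idfun u t) = u (contract t).
Proof.
move: t; apply: tens_eqfun => [x y|x y|x y]; rewrite ?raddfB //=.
by rewrite tmapE !contractE linearZ.
Qed.
End FreeRankOne.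

Section Main.
Variables (Fq : finFieldType) (A : comAlgType Fq) (p : prime_idealr A).
Variable (pi : A).
Local Notation Ap := (Ap p).
Local Notation Pi := (toAp p pi).
Hypothesis pi_unif : uniformizer p pi.
Variables (Kp : fieldType) (k : {rmorphism Ap -> Kp}).
Hypothesis k_frac : fraction_field k.
Variables (Fp : fieldExtType Fq) (red : {lrmorphism A -> Fp}).
Hypothesis red_p : residue_field p red.
Variable s : {rmorphism Fp -> Ap}.
Hypothesis s_red : is_section red s.
Variables (Omega : lmodType Ap) (D : Ap -> Omega).
Hypothesis Omega_diff : cont_differentials pi s D.
Variable res : Kp -> Fp.
Hypothesis res_k : residue pi s k res.
Variable B : nat -> seq A.
Hypothesis B_basis : adapted_basis p B.
Variable V : fq_module A.
Hypothesis V_alg : forall c v, fqm_act V c%:A v = c *: v.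
Local Notation PT := (ptensor p V).
Local Notation FpV := (tensor Fp V).
Local Notation KA := (fquot k).
Let s_alg : forall c : Fq, s c%:A = toAp p c%:A :=
  section_alg pi_unif red_p s_red.
Local Notation J := (pairing pi_unif k_frac red_p s_red s_alg (V := V)).
Local Notation digit := (digit pi_unif k_frac red_p s_red).

(** For x = a / Pi^(n+1) each residue is the n-th digit of a f b. It vanishes for b in p^(n+1), and
    the value of the pairing is read at level n, where h is the sum of the remaining terms. *)
Lemma pairing_formal (f : Ap) (u : forall n, 'I_(size (B n)) -> V) (h : PT)
    (x : Kp) : is_formal_sum u h ->
  is_finite_sum (fun n i => tens (res (x * k (toAp p (B n)`_i) * k f)) (u n i))
    (J (f *: h) (fclass k x)).
Proof.
move=> hu; have [a [n ->]] := frac_Pi pi_unif k_frac red_p s_red x.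
have resE m (i : 'I_(size (B m))) :
    res (k a / k (Pi ^+ n.+1) * k (toAp p (B m)`_i) * k f) =
    digit n (a * f * toAp p (B m)`_i).
  rewrite -(res_frac pi_unif k_frac red_p s_red res_k) !rmorphM /=.
  by congr res; ring.
exists n.+1; split=> [m i nm|].
  have [Bp _ _ _] := B_basis.
  suff -> : res (k a / k (Pi ^+ n.+1) * k (toAp p (B m)`_i) * k f) = 0.
    exact: tens0l.
  rewrite resE -(raddf0 (digit n)); apply: digit_Apc.
  by rewrite rmorphM raddf0 /= Apc_toAp (b_gt Bp) ?mulr0.
rewrite -[fclass _ _]/(pfrac pi k a n.+1) pairingE scalerA.
rewrite /coef pt_scale_Apc hu [X in tmap _ _ X]raddf_sum [LHS]raddf_sum.
apply: eq_bigr => m _ /=; rewrite [X in tmap _ _ X]raddf_sum [LHS]raddf_sum.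
apply: eq_bigr => i _; rewrite /= !tmapE resE /= /mulAq -Apc_toAp -rmorphM /=.
congr tens.
exact: (tau_Apc pi_unif k_frac red_p s_red).
Qed.

(** The local statement, for an A-module V on which the constants of A act by scalars. *)
Theorem local_pairing :
  let dpi := D Pi in
  (forall h : PT, exists! u : forall n, 'I_(size (B n)) -> V,
     is_formal_sum u h) /\
  exists j1 : tensor Omega PT -> homz KA FpV,
    let j2 : homz KA FpV -> homz KA V := homz_post (@tr_id _ Fp V) in
    let jt : tensor Omega (Hhat p V) -> homz KA FpV :=
      j1 \o tmap idfun (@Hincl _ _ p V) in
    [/\ forall (f : Ap) (u : forall n, 'I_(size (B n)) -> V) (h : ptensor p V)
          (x : Kp), is_formal_sum u h ->
          is_finite_sum
            (fun n i => tens (res (x * k (toAp p (B n)`_i) * k f)) (u n i))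
            (j1 (tens (f *: dpi) h) (fclass k x)),
        biiso_on (fun a => tmap idfun (@pt_act _ _ p V a))
          (fun a => homz_post (@FpV_act _ _ Fp V a))
          (fun=> True) (@Hom_Fp _ _ _ _ s KA V) j1,
        biiso_on (fun a => homz_post (@FpV_act _ _ Fp V a))
          (fun a => homz_post (fqm_act V a))
          (@Hom_Fp _ _ _ _ s KA V) (@Hom_Fq _ _ _ KA V) j2,
        biiso_on (fun a => tmap idfun (@Hhat_act _ _ p V a))
          (fun a => homz_post (@FpV_act _ _ Fp V a))
          (fun=> True) (@Hom_FpA _ _ _ _ s KA V) jt
          /\
        biiso_on (fun a => homz_post (@FpV_act _ _ Fp V a))
          (fun a => homz_post (fqm_act V a))
          (@Hom_FpA _ _ _ _ s KA V) (@tate_module _ _ _ _ k V) j2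
      & iso_on (fun=> True) (@tate_module _ _ _ _ k V)
          (fun h : Hhat p V => j2 (jt (tens dpi h)))].
Proof.
move=> dpi; split.
  by have [Bp Bb _ _] := B_basis; apply: (formal_sum_exists_unique Bp Bb).
have [g [g1 gw]] := differentials_basis pi_unif k_frac red_p s_red Omega_diff.
have ctr1 (N : lmodType Ap) (h : N) : contract g (tens dpi h) = h.
  by rewrite contractE g1 scale1r.
have ctrK (N : lmodType Ap) (t : tensor Omega N) : t = tens dpi (contract g t).
  exact: contractK.
have JI := @pairing_inj _ _ _ _ pi_unif _ _ k_frac _ _ red_p _ s_red s_alg V.
pose j1 (t : tensor Omega PT) := J (contract g t).
have j1t (t : tensor Omega (Hhat p V)) :
    j1 (tmap idfun (@Hincl _ _ p V) t) = J (Hincl (contract g t)).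
  by rewrite /j1 contract_tmap.
(* [J] turns phi_a into the action on values and multiplication by a into the action on arguments;
   being injective, it matches the two A-linearity conditions. *)
have J_FpA (h : PT) : Hom_FpA s (J h) <-> Hhat_pred h.
  split=> [[_ hA]|/asboolP hA]; last first.
    split=> [|a x]; first exact: pairing_Fp.
    by have := congr1 (fun f : homz KA FpV => f x)
         (pairing_act pi_unif k_frac red_p s_red s_alg a h);
       rewrite /= hA linearZ.
  apply/asboolP => a; apply: JI; rewrite pairing_act linearZ.
  by apply: homzP => x; rewrite /= -hA.
have j2_iso : biiso_on (fun a => homz_post (@FpV_act _ _ Fp V a))
    (fun a => homz_post (fqm_act V a))
    (@Hom_Fp _ _ _ _ s KA V) (@Hom_Fq _ _ _ KA V)
    (homz_post (@tr_id _ Fp V)).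
  split; last by move=> a f _; apply: post_tr_act.
  split; first exact: post_tr_linear.
  - by move=> f; apply: post_tr_Fq.
  - by move=> f f'; apply: post_tr_inj.
  - by move=> f /(post_tr_surj s_alg).
have j2_isoA : iso_on (@Hom_FpA _ _ _ _ s KA V) (@tate_module _ _ _ _ k V)
    (homz_post (@tr_id _ Fp V)).
  split; first exact: post_tr_linear.
  - exact: post_tr_FpA.
  - by move=> f f' [fs _] [fs' _]; apply: (post_tr_inj fs fs').
  - move=> f fA; have [|f' fs' ff'] := @post_tr_surj _ _ _ _ _ _ s_alg _ f.
      (* A-linear maps are F_q-linear because the constants of A act on V as scalars. *)
      by move=> c x; rewrite fA V_alg.
    by exists f' => //; apply: post_tr_A => //; rewrite ff'.
have jt_iso : iso_on (fun=> True) (@Hom_FpA _ _ _ _ s KA V)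
    (j1 \o tmap idfun (@Hincl _ _ p V)).
  split.
  - by move=> a t u; rewrite /= !j1t !linearP.
  - by move=> t _; rewrite /= j1t; apply/J_FpA; apply: valP.
  - move=> t u _ _; rewrite /= !j1t => /JI/val_inj tu.
    by rewrite (ctrK _ t) (ctrK _ u) tu.
  - move=> f fA; have [h hf] := pairing_surj pi_unif k_frac red_p s_red s_alg fA.1.
    have hH : Hhat_pred h by apply/J_FpA; rewrite hf.
    exists (tens dpi (Sub h hH : Hhat p V)) => //.
    by rewrite /= j1t ctr1.
exists j1; split=> [f u h x hu|||| ].
- have gf : g (f *: dpi) = f by rewrite linearZ /= g1; apply: mulr1.
  by rewrite /j1 contractE gf; apply: pairing_formal.
- split; last first.
    by move=> a t _; rewrite /j1 contract_tmap pairing_act.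
  split=> [a t u|t _|t u _ _ /JI tu|f fs].
  + by rewrite /j1 !linearP.
  + exact: pairing_Fp.
  + by rewrite (ctrK _ t) (ctrK _ u) tu.
  + have [h hf] := pairing_surj pi_unif k_frac red_p s_red s_alg fs.
    by exists (tens dpi h) => //; rewrite /j1 ctr1.
- exact: j2_iso.
- split; split; [exact: jt_iso| |exact: j2_isoA|].
    move=> a t _; rewrite /= !j1t contract_tmap.
    rewrite -[Hincl _]/(pt_act a (Hincl (contract g t))).
    by rewrite pairing_act.
  by move=> a f _; apply: post_tr_act.
(* The map h |-> dpi (x) h is bijective with inverse [contract g], so it can be composed with the
   two isomorphisms. *)
- have [l1 m1 i1 s1] := jt_iso; have [l2 m2 i2 s2] := j2_isoA.
  have tens_lin (b : Ap) (h h' : Hhat p V) :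
      tens dpi (b *: h + h') = b *: tens dpi h + tens dpi h'.
    by rewrite tensDr tensZr.
  split.
  + by move=> b h h'; rewrite tens_lin l1 l2.
  + by move=> h _; apply/m2/m1.
  + move=> h h' _ _ /i2 e; rewrite -(ctr1 _ h) -(ctr1 _ h').
    by congr contract; apply: i1 => //; apply: e; apply: m1.
  + move=> f /s2[f' /s1[t _ tf'] ff']; exists (contract g t) => //.
    by rewrite -ctrK tf'.
Qed.
End Main.

Theorem theorem4p4
  (Fq : finFieldType)
  (* the curve C, the point oo, and A *)
  (K : fieldType) (iota : {rmorphism Fq -> K}) (hC : curve iota)
  (Oinf : K -> Prop) (hinf : closed_point iota Oinf)
  (A : comAlgType Fq) (j : {rmorphism A -> K}) (hA : coordinate_ring iota Oinf j)
  (* C_oo *)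
  (Kbar : closedFieldType) (kbar : {rmorphism K -> Kbar})
  (hKbar : forall y, algebraicOver kbar y)
  (Obar : Kbar -> Prop) (hObar : place_above Oinf kbar Obar)
  (Cinf : fieldType) (c : {rmorphism Kbar -> Cinf}) (O : Cinf -> Prop)
  (hCinf : completion_of c Obar O)
  (* K <= L <= C_oo *)
  (L : fieldType) (l : {rmorphism K -> L}) (e : {rmorphism L -> Cinf})
  (hL : forall x, e (l x) = c (kbar x))
  (d : nat) (E : anderson_module (l \o iota) (l \o j) d)
  (* p, A / p, A_p, K_p *)
  (p : prime_idealr A) (hp : exists2 a, a \in p & a != 0)
  (pi : A) (hpi : uniformizer p pi)
  (Fp : fieldExtType Fq) (red : {lrmorphism A -> Fp}) (hFp : residue_field p red)
  (s : {rmorphism Fp -> Ap p}) (hs : is_section red s)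
  (Kp : fieldType) (k : {rmorphism Ap p -> Kp}) (hKp : fraction_field k)
  (Omega : lmodType (Ap p)) (D : Ap p -> Omega)
  (hOmega : cont_differentials pi s D)
  (res : Kp -> Fp) (hres : residue pi s k res)
  (B : nat -> seq A) (hB : adapted_basis p B) :
  let V := am_points E (algvia e) in
  let dpi := D (toAp p pi) in
  let KA := fquot k in
  (forall h : ptensor p V, exists! u : forall n, 'I_(size (B n)) -> V,
     is_formal_sum u h) /\
  exists j1 : tensor Omega (ptensor p V) -> homz KA (tensor Fp V),
    let j2 : homz KA (tensor Fp V) -> homz KA V := homz_post (@tr_id _ Fp V) in
    let jt : tensor Omega (Hhat p V) -> homz KA (tensor Fp V) :=
      j1 \o tmap idfun (@Hincl _ _ p V) in
    [/\ forall (f : Ap p) (u : forall n, 'I_(size (B n)) -> V) (h : ptensor p V)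
          (x : Kp), is_formal_sum u h ->
          is_finite_sum
            (fun n i => tens (res (x * k (toAp p (B n)`_i) * k f)) (u n i))
            (j1 (tens (f *: dpi) h) (fclass k x)),
        biiso_on (fun a => tmap idfun (@pt_act _ _ p V a))
          (fun a => homz_post (@FpV_act _ _ Fp V a))
          (fun=> True) (@Hom_Fp _ _ _ _ s KA V) j1,
        biiso_on (fun a => homz_post (@FpV_act _ _ Fp V a))
          (fun a => homz_post (fqm_act V a))
          (@Hom_Fp _ _ _ _ s KA V) (@Hom_Fq _ _ _ KA V) j2,
        biiso_on (fun a => tmap idfun (@Hhat_act _ _ p V a))
          (fun a => homz_post (@FpV_act _ _ Fp V a))
          (fun=> True) (@Hom_FpA _ _ _ _ s KA V) jt
          /\
        biiso_on (fun a => homz_post (@FpV_act _ _ Fp V a))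
          (fun a => homz_post (fqm_act V a))
          (@Hom_FpA _ _ _ _ s KA V) (@tate_module _ _ _ _ k V) j2
      & iso_on (fun=> True) (@tate_module _ _ _ _ k V)
          (fun h : Hhat p V => j2 (jt (tens dpi h)))].
Proof.
move=> V dpi KA.
apply: (local_pairing hpi hKp hFp hs hOmega hres hB) => a v.
apply: anderson_scalar => b; have [_ jalg _] := hA.
by rewrite /= jalg.
Qed.
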